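(* Let $n\ge 2$ and $\mathbf{r}=(r_1,r_2,r_3)\in\mathbb{Z}_{\ge 0}^3$ with $r_1+r_2+r_3=n$. For generic parameters ($\kappa\in\mathbb{C}$ and $\underline{\phi}\in\mathbb{C}^3$) there exists a unique isomorphism of $H_n(q)$-modules $$\psi^{(\mathbf{r})}: M^{I^{(\mathbf{r})},\epsilon^{(\mathbf{r})}}(\gamma^{(\mathbf{r})})\overset{\sim}{\longrightarrow}(V^{\otimes n})_{\mathbf{r}}$$ mapping the cyclic vector $v^{I^{(\mathbf{r})},\epsilon^{(\mathbf{r})}}(\gamma^{(\mathbf{r})})$ to $$\mathbf{v}_{\alpha^{(\mathbf{r})}}=v_3^{\otimes r_3}\otimes v_2^{\otimes r_2}\otimes v_1^{\otimes r_1}\in(V^{\otimes n})_{\mathbf{r}}.$$ Furthermore, for $w\in S_n^{I^{(\mathbf{r})}}$, $$\psi^{(\mathbf{r})}\bigl(v_w^{I^{(\mathbf{r})},\epsilon^{(\mathbf{r})}}(\gamma^{(\mathbf{r})})\bigr)=(-1)^{\eta(w)}\,\mathbf{v}_{w\alpha^{(\mathbf{r})}},$$ where $$\eta(w):=\#\{(i,j)\ |\ 1\le j\le r_3<i\le n\ \text{ and }\ w(i)<w(j)\}.$$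
   Context: Fix $0<p<1$, a generic $\kappa\in\mathbb{C}$, $q:=p^{-\kappa}$ ($p^a:=e^{a\log p}$, $\log p\in\mathbb{R}$). ''Generic'' has its usual meaning: outside a countable union of zero sets of nonzero holomorphic functions of the parameters. Extended affine Hecke algebra: $H_n(q)$ is the unital associative $\mathbb{C}$-algebra generated by $T_1,\dots,T_{n-1},\zeta^{\pm1}$ with relations $T_iT_{i+1}T_i=T_{i+1}T_iT_{i+1}$ ($1\le i<n-1$), $T_iT_j=T_jT_i$ ($|i-j|>1$), $(T_i-q)(T_i+q^{-1})=0$, $\zeta\zeta^{-1}=1=\zeta^{-1}\zeta$, $\zeta T_i=T_{i+1}\zeta$ ($1\le i<n-1$), $\zeta^2T_{n-1}=T_1\zeta^2$. Put $Y_i:=T_{i-1}^{-1}\cdots T_1^{-1}\zeta T_{n-1}\cdots T_{i+1}T_i$ ($1\le i\le n$); these commute. Principal series: $S_n$ is the symmetric group with simple transpositions $s_i=(i\ i{+}1)$ and length function $l$. For $I\subseteq\{1,\dots,n-1\}$, $S_{n,I}$ is generated by $s_i$ ($i\in I$), and $S_n^I=\{w\in S_n\,|\,l(ws_i)=l(w)+1\ \forall i\in I\}$. $H_I(q)\subseteq H_n(q)$ is the subalgebra generated by $T_i$ ($i\in I$) and $Y_j^{\pm1}$ ($1\le j\le n$). For signs $\epsilon=(\epsilon_i)_{i\in I}$ with $\epsilon_i=\epsilon_j$ whenever $s_i,s_j$ are conjugate in $S_{n,I}$, let $E^{I,\epsilon}=\{\gamma\in\mathbb{C}^n\,|\,\gamma_i-\gamma_{i+1}=2\epsilon_i\kappa\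 \forall i\in I\}$. For $\gamma\in E^{I,\epsilon}$ there is a unique linear character $\chi_\gamma^{I,\epsilon}:H_I(q)\to\mathbb{C}$ with $\chi_\gamma^{I,\epsilon}(T_i)=\epsilon_iq^{\epsilon_i}$ ($i\in I$), $\chi_\gamma^{I,\epsilon}(Y_j)=p^{-\gamma_j}$. The principal series module is $M^{I,\epsilon}(\gamma):=H_n(q)\otimes_{H_I(q)}\mathbb{C}_{\chi_\gamma^{I,\epsilon}}$, with cyclic vector $v^{I,\epsilon}(\gamma):=1\otimes 1$. For $w\in S_n$ with reduced expression $w=s_{i_1}\cdots s_{i_l}$ put $T_w=T_{i_1}\cdots T_{i_l}$, and $v_w^{I,\epsilon}(\gamma):=T_wv^{I,\epsilon}(\gamma)$ for $w\in S_n^I$. Spin representation: $V=\mathbb{C}v_1\oplus\mathbb{C}v_2\oplus\mathbb{C}v_3$ with parity $p(1)=p(2)=\overline 0$, $p(3)=\overline 1$. $\mathcal{B}\in\mathrm{End}(V\otimes V)$ is given by $\mathcal{B}(v_i\otimes v_i)=q\,v_i\otimes v_i$ for $i=1,2$, $\mathcal{B}(v_3\otimes v_3)=-q^{-1}v_3\otimes v_3$, and for $i<j$: $\mathcal{B}(v_i\otimes v_j)=(q-q^{-1})v_i\otimes v_j+(-1)^{p(i)+p(j)}v_j\otimes v_i$, $\mathcal{B}(v_j\otimes v_i)=(-1)^{p(i)+p(j)}v_i\otimes v_j$. It satisfies the braid relation and $(\mathcal{B}-q)(\mathcal{B}+q^{-1})=0$. For $\underline\phi\in\mathbb{C}^3$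 let $D_{\underline\phi}v_i=p^{-\phi_i}v_i$. The spin representation $\pi_{\mathcal{B},\underline\phi}:H_n(q)\to\mathrm{End}(V^{\otimes n})$ is determined by $T_i\mapsto\mathcal{B}_{i,i+1}$ and $\zeta\mapsto P_{12}P_{23}\cdots P_{n-1,n}(D_{\underline\phi})_n$ with $P$ the (non-graded) flip. For $\alpha=(\alpha_1,\dots,\alpha_n)\in\{1,2,3\}^n$ put $\mathbf{v}_\alpha=v_{\alpha_1}\otimes\cdots\otimes v_{\alpha_n}$; $\mathcal{K}_n[\mathbf{r}]$ is the set of $\alpha$ with exactly $r_j$ entries equal to $j$ ($j=1,2,3$), and $(V^{\otimes n})_{\mathbf{r}}:=\mathrm{span}\{\mathbf{v}_\alpha\,|\,\alpha\in\mathcal{K}_n[\mathbf{r}]\}$, an $H_n(q)$-submodule of $(\pi_{\mathcal{B},\underline\phi},V^{\otimes n})$. $S_n$ acts on $\mathcal{K}_n[\mathbf r]$ by $(w\alpha)_i=\alpha_{w^{-1}(i)}$. Let $\alpha^{(\mathbf{r})}:=(3,\dots,3,2,\dots,2,1,\dots,1)$ with $r_3$ threes, $r_2$ twos, $r_1$ ones. Data attached to $\mathbf r$: $I^{(\mathbf{r})}:=\{1,\dots,n-1\}\setminus(\{r_3,r_2+r_3\}\cap\{1,\dots,n-1\})$; $\epsilon^{(\mathbf{r})}_i:=-$ if $i<r_3$ and $+$ otherwise ($i\in I^{(\mathbf r)}$); and $\gamma^{(\mathbf{r})}\in E^{I^{(\mathbf{r})},\epsilon^{(\mathbf{r})}}$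 is $$\gamma_i^{(\mathbf{r})}:=\begin{cases}\eta_3^{(\mathbf{r})}+\phi_3+2i\kappa,& i\le r_3,\\ \eta_2^{(\mathbf{r})}+\phi_2-2(i-r_3)\kappa,& r_3<i\le r_3+r_2,\\ \eta_1^{(\mathbf{r})}+\phi_1-2(i-r_2-r_3)\kappa,& r_3+r_2<i\le n,\end{cases}$$ with $\eta_1^{(\mathbf{r})}=-\pi\sqrt{-1}\,r_3\log(p)^{-1}+(r_1+1)\kappa$, $\eta_2^{(\mathbf{r})}=-\pi\sqrt{-1}\,r_3\log(p)^{-1}+(r_2+1)\kappa$, $\eta_3^{(\mathbf{r})}=-\pi\sqrt{-1}(n-1)\log(p)^{-1}-(r_3+1)\kappa$. *)

(* Defs.v *)
From HB Require Import structures.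
From mathcomp Require Import all_boot all_order all_fingroup all_algebra.
From mathcomp Require Import complex.
From mathcomp Require Import all_classical all_reals all_analysis.
From mathcomp Require Import generic_quotient.
From mathcomp Require Import ring lra zify.

Set Implicit Arguments.
Unset Strict Implicit.
Unset Printing Implicit Defensive.

Import Order.TTheory GRing.Theory Num.Theory.
Import numFieldNormedType.Exports.

Local Open Scope quotient_scope.
Local Open Scope ring_scope.

Section PresentedAlgebra.
Variables (K : fieldType) (X : Type).

Inductive alg_expr : Type :=
| Gen of X
| Cst of K
| Add of alg_expr & alg_expr
| Mul of alg_expr & alg_expr.

HB.instance Definition _ := gen_eqMixin alg_expr.
HB.instance Definition _ := gen_choiceMixin alg_expr.

Variable rels : alg_expr -> alg_expr -> Prop.

(* The smallest congruence containing rels whose quotient is a unital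
   associative K-algebra, the scalar c being c times the unit. *)
Inductive alg_eq : alg_expr -> alg_expr -> Prop :=
| alg_rel s t : rels s t -> alg_eq s t
| alg_refl s : alg_eq s s
| alg_sym s t : alg_eq s t -> alg_eq t s
| alg_trans s t u : alg_eq s t -> alg_eq t u -> alg_eq s u
| alg_addE s s' t t' : alg_eq s s' -> alg_eq t t' -> alg_eq (Add s t) (Add s' t')
| alg_mulE s s' t t' : alg_eq s s' -> alg_eq t t' -> alg_eq (Mul s t) (Mul s' t')
| alg_addA s t u : alg_eq (Add s (Add t u)) (Add (Add s t) u)
| alg_addC s t : alg_eq (Add s t) (Add t s)
| alg_add0 s : alg_eq (Add (Cst 0) s) s
| alg_addN s : alg_eq (Add (Mul (Cst (-1)) s) s) (Cst 0)
| alg_mulA s t u : alg_eq (Mul s (Mul t u)) (Mul (Mul s t) u)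
| alg_mul1 s : alg_eq (Mul (Cst 1) s) s
| alg_mulDl s t u : alg_eq (Mul (Add s t) u) (Add (Mul s u) (Mul t u))
| alg_mulDr s t u : alg_eq (Mul s (Add t u)) (Add (Mul s t) (Mul s u))
| alg_cstD c d : alg_eq (Cst (c + d)) (Add (Cst c) (Cst d))
| alg_cstM c d : alg_eq (Cst (c * d)) (Mul (Cst c) (Cst d))
| alg_cstC c s : alg_eq (Mul (Cst c) s) (Mul s (Cst c)).

Definition alg_eqb (s t : alg_expr) : bool := `[< alg_eq s t >].

Let alg_eqb_refl : reflexive alg_eqb.
Proof. by move=> s; apply/asboolP; apply: alg_refl. Qed.
Let alg_eqb_sym : symmetric alg_eqb.
Proof. by move=> s t; apply/asboolP/asboolP; apply: alg_sym. Qed.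
Let alg_eqb_trans : transitive alg_eqb.
Proof.
by move=> s t u /asboolP st /asboolP su; apply/asboolP; apply: alg_trans st su.
Qed.

Canonical alg_equiv := EquivRel alg_eqb alg_eqb_refl alg_eqb_sym alg_eqb_trans.

Definition presented : Type := {eq_quot alg_equiv}.
HB.instance Definition _ := Choice.on presented.
HB.instance Definition _ : EqQuotient alg_expr alg_equiv presented :=
  EqQuotient.on presented.

Definition presented_of (s : alg_expr) : presented := \pi_presented s.

Lemma presented_eqP s t : presented_of s = presented_of t <-> alg_eq s t.
Proof.
rewrite /presented_of; split; first by move/eqmodP => /asboolP.
by move=> st; apply/eqmodP/asboolP.
Qed.

Lemma presented_surj x : exists s, x = presented_of s.
Proof. by exists (repr x); rewrite /presented_of reprK. Qed.

Lemma presented_repr s : alg_eq (repr (presented_of s)) s.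
Proof. by apply/presented_eqP; rewrite /presented_of reprK. Qed.

Definition padd (x y : presented) := presented_of (Add (repr x) (repr y)).
Definition pmul (x y : presented) := presented_of (Mul (repr x) (repr y)).
Definition pscale (c : K) (x : presented) := presented_of (Mul (Cst c) (repr x)).
Definition popp (x : presented) := pscale (-1) x.

Lemma presented_addE s t : padd (presented_of s) (presented_of t) = presented_of (Add s t).
Proof. by apply/presented_eqP; apply: alg_addE; exact: presented_repr. Qed.
Lemma presented_mulE s t : pmul (presented_of s) (presented_of t) = presented_of (Mul s t).
Proof. by apply/presented_eqP; apply: alg_mulE; exact: presented_repr. Qed.
Lemma presented_scaleE c s : pscale c (presented_of s) = presented_of (Mul (Cst c) s).
Proof.
by apply/presented_eqP; apply: alg_mulE; [exact: alg_refl|exact: presented_repr].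
Qed.

Local Ltac lift := repeat (let x := fresh "x" in move=> x; case: (presented_surj x) => {x} ? ->);
  rewrite /popp ?(presented_addE, presented_mulE, presented_scaleE);
  apply/presented_eqP.

Let paddA : associative padd. Proof. lift; exact: alg_addA. Qed.
Let paddC : commutative padd. Proof. lift; exact: alg_addC. Qed.
Let padd0 : left_id (presented_of (Cst 0)) padd.
Proof. lift; exact: alg_add0. Qed.

Let paddN : left_inverse (presented_of (Cst 0)) popp padd.
Proof. lift; exact: alg_addN. Qed.
Let pmulA : associative pmul. Proof. lift; exact: alg_mulA. Qed.
Let pmul1l : left_id (presented_of (Cst 1)) pmul.
Proof. lift; exact: alg_mul1. Qed.
Let pmul1r : right_id (presented_of (Cst 1)) pmul.
Proof. lift; exact: alg_trans (alg_sym (alg_cstC _ _)) (alg_mul1 _). Qed.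
Let pmulDl : left_distributive pmul padd. Proof. lift; exact: alg_mulDl. Qed.
Let pmulDr : right_distributive pmul padd. Proof. lift; exact: alg_mulDr. Qed.

HB.instance Definition _ := GRing.isZmodule.Build presented paddA paddC padd0 paddN.
HB.instance Definition _ := GRing.Zmodule_isPzRing.Build presented
  pmulA pmul1l pmul1r pmulDl pmulDr.

Let pscaleA a b v : pscale a (pscale b v) = pscale (a * b) v.
Proof.
move: v; lift; apply: alg_trans (alg_mulA _ _ _) _.
exact: alg_mulE (alg_sym (alg_cstM _ _)) (alg_refl _).
Qed.
Let pscale1 : left_id 1 pscale. Proof. lift; exact: alg_mul1. Qed.
Let pscaleDr : right_distributive pscale padd.
Proof. move=> c; lift; exact: alg_mulDr. Qed.
Let pscaleDl v : {morph pscale^~ v : a b / a + b >-> padd a b}.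
Proof.
move=> a b; move: v; lift; apply: alg_trans _ (alg_mulDl _ _ _).
exact: alg_mulE (alg_cstD _ _) (alg_refl _).
Qed.

HB.instance Definition _ := GRing.Zmodule_isLmodule.Build K presented
  pscaleA pscale1 pscaleDr pscaleDl.

Lemma presented_scaleAl (a : K) (u v : presented) : a *: (u * v) = (a *: u) * v.
Proof. by rewrite /GRing.scale /GRing.mul /=; move: u v; lift; exact: alg_mulA. Qed.

Lemma presented_scaleAr (a : K) (u v : presented) : a *: (u * v) = u * (a *: v).
Proof.
rewrite /GRing.scale /GRing.mul /=; move: u v; lift.
apply: alg_trans (alg_mulA _ _ _) _; apply: alg_trans _ (alg_sym (alg_mulA _ _ _)).
exact: alg_mulE (alg_cstC _ _) (alg_refl _).
Qed.

Lemma presentedD s t : presented_of (Add s t) = presented_of s + presented_of t.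
Proof. by rewrite -presented_addE. Qed.
Lemma presentedM s t : presented_of (Mul s t) = presented_of s * presented_of t.
Proof. by rewrite -presented_mulE. Qed.
Lemma presentedC c : presented_of (Cst c) = c *: (1 : presented).
Proof.
rewrite /GRing.scale /= presented_scaleE; apply/presented_eqP.
exact: alg_trans (alg_sym (alg_mul1 _)) (alg_cstC _ _).
Qed.

End PresentedAlgebra.

Section PresentedAction.
Variables (K : fieldType) (X : Type) (rels : alg_expr K X -> alg_expr K X -> Prop).
Variables (W : lmodType K) (ops : X -> {linear W -> W}).

Fixpoint expr_act (s : alg_expr K X) (w : W) : W :=
  match s with
  | Gen x => ops x w
  | Cst c => c *: w
  | Add s t => expr_act s w + expr_act t w
  | Mul s t => expr_act s (expr_act t w)
  end.

Definition presented_act (h : presented rels) (w : W) : W := expr_act (repr h) w.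

Lemma expr_act_linear s : linear (expr_act s).
Proof.
elim: s => [x|c|s IHs t IHt|s IHs t IHt] a u v /=.
- by rewrite linearP.
- by rewrite scalerDr !scalerA mulrC.
- by rewrite IHs IHt scalerDr addrACA.
- by rewrite IHt IHs.
Qed.

Hypothesis ops_rels : forall s t, rels s t -> expr_act s =1 expr_act t.

Lemma expr_act_eq s t : alg_eq rels s t -> expr_act s =1 expr_act t.
Proof.
have lin s' : linear (expr_act s') := expr_act_linear s'.
elim=> {s t} //=.
- by move=> s t _ IH w; rewrite IH.
- by move=> s t u _ IH1 _ IH2 w; rewrite IH1 IH2.
- by move=> s s' t t' _ IH1 _ IH2 w; rewrite IH1 IH2.
- by move=> s s' t t' _ IH1 _ IH2 w; rewrite IH1 IH2.
- by move=> s t u w; rewrite addrA.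
- by move=> s t w; rewrite addrC.
- by move=> s w; rewrite scale0r add0r.
- by move=> s w; rewrite scaleN1r addNr scale0r.
- by move=> s w; rewrite scale1r.
- by move=> s t u w; have := lin s 1 (expr_act t w) (expr_act u w); rewrite !scale1r.
- by move=> c d w; rewrite scalerDl.
- by move=> c d w; rewrite scalerA.
- move=> c s w; have s0 : expr_act s 0 = 0.
    by have := lin s (-1) 0 0; rewrite scaler0 addr0 scaleN1r addNr.
  by have := lin s c w 0; rewrite s0 !addr0.
Qed.

Lemma presented_actE s w : presented_act (presented_of rels s) w = expr_act s w.
Proof. exact/expr_act_eq/presented_repr. Qed.

Lemma presented_actA g h w :
  presented_act g (presented_act h w) = presented_act (g * h) w.
Proof.
case: (presented_surj g) => s ->; case: (presented_surj h) => t ->.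
by rewrite -presentedM !presented_actE.
Qed.

Lemma presented_act1 : left_id 1 presented_act.
Proof. by move=> w; rewrite (presented_actE (Cst X 1)) /= scale1r. Qed.

Lemma presented_actDr : right_distributive presented_act +%R.
Proof.
by move=> h u v; have := expr_act_linear (repr h) 1 u v; rewrite !scale1r.
Qed.

Lemma presented_actDl w : {morph presented_act^~ w : g h / g + h}.
Proof.
move=> g h; case: (presented_surj g) => s ->; case: (presented_surj h) => t ->.
by rewrite -presentedD !presented_actE.
Qed.

Lemma presented_actZ c w : presented_act (c *: (1 : presented rels)) w = c *: w.
Proof. by rewrite -presentedC presented_actE. Qed.

End PresentedAction.

(* The affine Hecke algebra of rank n = m + 2; T_i (1 <= i <= n - 1) is
   [GenT i'] with i' = i - 1, of type 'I_(m + 1). *)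
Inductive hecke_gen (m : nat) : Type :=
| GenT of 'I_m.+1
| GenZ
| GenZV.
Arguments GenZ {m}.
Arguments GenZV {m}.

Section AffineHecke.
Variables (K : fieldType) (m : nat) (q : K).

Local Notation expr := (alg_expr K (hecke_gen m)).
Local Notation t i := (Gen K (GenT i)).
Local Notation z := (Gen K GenZ : expr).
Local Notation zV := (Gen K GenZV : expr).
Local Notation "x ** y" := (Mul x y) (at level 40, left associativity).
Local Notation cst c := (Cst (hecke_gen m) c).

Inductive hecke_rel : expr -> expr -> Prop :=
| hecke_braid (i j : 'I_m.+1) : j = i.+1 :> nat ->
    hecke_rel (t i ** t j ** t i) (t j ** t i ** t j)
| hecke_comm (i j : 'I_m.+1) : (i.+1 < j)%N || (j.+1 < i)%N ->
    hecke_rel (t i ** t j) (t j ** t i)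
| hecke_quad (i : 'I_m.+1) :
    hecke_rel (Add (t i) (cst (- q)) ** Add (t i) (cst q^-1)) (cst 0)
| hecke_zzV : hecke_rel (z ** zV) (cst 1)
| hecke_zVz : hecke_rel (zV ** z) (cst 1)
| hecke_zT (i j : 'I_m.+1) : j = i.+1 :> nat -> hecke_rel (z ** t i) (t j ** z)
| hecke_zzT : hecke_rel (z ** z ** t ord_max) (t ord0 ** (z ** z)).

Definition hecke : Type := presented hecke_rel.
HB.instance Definition _ := GRing.PzRing.on hecke.
HB.instance Definition _ := GRing.Lmodule.on hecke.

Let triv_op (x : hecke_gen m) (w : K^o) : K^o := if x is GenT _ then q *: w else w.
Let triv_op_linear x : linear (triv_op x).
Proof.
by case: x => [i| |] a u v //=; rewrite /triv_op scalerDr !scalerA mulrC.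
Qed.
HB.instance Definition _ x := GRing.isLinear.Build K K^o K^o _ _ (triv_op_linear x).

Lemma hecke_oner_neq0 : (1 : hecke) != 0.
Proof.
apply/eqP => e10.
have ok s t : hecke_rel s t ->
    expr_act (fun x => triv_op x : {linear _ -> _}) s
    =1 expr_act (fun x => triv_op x : {linear _ -> _}) t.
  case=> {s t} //=; rewrite /triv_op /=.
  - by move=> i w; rewrite scaleNr subrr scale0r.
  - by move=> w; rewrite scale1r.
  - by move=> w; rewrite scale1r.
have := congr1 (fun h : hecke => presented_act (fun x => triv_op x : {linear _ -> _}) h 1) e10.
rewrite (presented_actE ok (cst 1)) (presented_actE ok (cst 0)) /= scale1r scale0r.
by move/eqP; rewrite oner_eq0.
Qed.

HB.instance Definition _ := GRing.PzSemiRing_isNonZero.Build hecke hecke_oner_neq0.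
HB.instance Definition _ :=
  GRing.Lmodule_isLalgebra.Build K hecke (@presented_scaleAl _ _ hecke_rel).
HB.instance Definition _ :=
  GRing.Lalgebra_isAlgebra.Build K hecke (@presented_scaleAr _ _ hecke_rel).

Definition heT (i : 'I_m.+1) : hecke := presented_of hecke_rel (t i).
Definition heZ : hecke := presented_of hecke_rel z.
Definition heZV : hecke := presented_of hecke_rel zV.

(* T_i^-1, see heTK and heTVK. *)
Definition heTV (i : 'I_m.+1) : hecke := heT i - (q - q^-1)%:A.

Local Notation idx := (enum 'I_m.+1).

(* Y_j, with j ranging over 'I_n: j = 0 stands for the index 1. *)
Definition heY (j : 'I_m.+2) : hecke :=
  (\prod_(i <- rev idx | (i < j)%N) heTV i) * heZ *
  (\prod_(i <- rev idx | (j <= i)%N) heT i).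

Definition heYV (j : 'I_m.+2) : hecke :=
  (\prod_(i <- idx | (j <= i)%N) heTV i) * heZV *
  (\prod_(i <- idx | (i < j)%N) heT i).

Lemma heT_quad i : (heT i - q%:A) * (heT i + q^-1%:A) = 0.
Proof.
have := (presented_eqP _ _ _).2 (alg_rel (hecke_quad i)).
by rewrite presentedM !presentedD !presentedC scale0r scaleNr.
Qed.

Lemma heZK : heZ * heZV = 1.
Proof.
have := (presented_eqP _ _ _).2 (alg_rel hecke_zzV).
by rewrite presentedM.
Qed.

Lemma heZVK : heZV * heZ = 1.
Proof.
have := (presented_eqP _ _ _).2 (alg_rel hecke_zVz).
by rewrite presentedM.
Qed.

Hypothesis q0 : q != 0.

Lemma heTK i : heT i * heTV i = 1.
Proof.
have := heT_quad i; rewrite /heTV; set T := heT i.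
rewrite mulrBl !mulrDr mulrN !mulr_algr !mulr_algl scalerA mulVf // scale1r.
move=> e; apply/eqP; rewrite -subr_eq0 -e scalerBl opprB opprD.
by rewrite !addrA.
Qed.

Lemma heTVK i : heTV i * heT i = 1.
Proof. by rewrite -(heTK i) /heTV mulrBr mulrBl mulr_algr mulr_algl. Qed.

Lemma heYK j : heY j * heYV j = 1 /\ heYV j * heY j = 1.
Proof.
have inv (P : pred 'I_m.+1) (F G : 'I_m.+1 -> hecke) : (forall i, F i * G i = 1) ->
    (\prod_(i <- rev idx | P i) F i) * (\prod_(i <- idx | P i) G i) = 1.
  move=> FG; elim: idx => [|i s IH]; first by rewrite !big_nil mulr1.
  rewrite rev_cons -cats1 big_cat !big_cons !big_nil /=; case: (P i); rewrite ?mulr1 //.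
  by rewrite mulrA -[_ * F i * _]mulrA FG mulr1.
have inv' (P : pred 'I_m.+1) (F G : 'I_m.+1 -> hecke) : (forall i, F i * G i = 1) ->
    (\prod_(i <- idx | P i) F i) * (\prod_(i <- rev idx | P i) G i) = 1.
  move=> FG; elim/last_ind: idx => [|s i IH]; first by rewrite !big_nil mulr1.
  rewrite rev_rcons -cats1 big_cat !big_cons !big_nil /=; case: (P i); rewrite ?mulr1 //.
  by rewrite mulrA -[_ * F i * _]mulrA FG mulr1.
rewrite /heY /heYV; set A := \prod_(i <- _ | _) _; set B := \prod_(i <- _ | _) _.
set C := \prod_(i <- _ | _) _; set D := \prod_(i <- _ | _) _.
have BC : B * C = 1 by apply: inv => i; apply: heTK.
have CB : C * B = 1 by apply: inv' => i; apply: heTVK.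
have AD : A * D = 1 by apply: inv => i; apply: heTVK.
have DA : D * A = 1 by apply: inv' => i; apply: heTK.
split.
  by rewrite -!mulrA (mulrA B) BC mul1r (mulrA heZ) heZK mul1r.
by rewrite -!mulrA (mulrA D) DA mul1r (mulrA heZV) heZVK mul1r.
Qed.

End AffineHecke.

Section InducedModule.
Variables (K : fieldType) (H : algType K) (A : set H) (chi : H -> K).

Inductive tens_expr : Type :=
| TZero
| TAdd of tens_expr & tens_expr
| TOpp of tens_expr
| TPure of H & K.

HB.instance Definition _ := gen_eqMixin tens_expr.
HB.instance Definition _ := gen_choiceMixin tens_expr.

(* The tensor product of H with the one-dimensional A-module K_chi, over the
   subalgebra A: the abelian group generated by the symbols h (x) c, subject to
   biadditivity and to (h a) (x) c = h (x) (chi a) c for a in A. *)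
Inductive tens_eq : tens_expr -> tens_expr -> Prop :=
| tens_refl s : tens_eq s s
| tens_sym s t : tens_eq s t -> tens_eq t s
| tens_trans s t u : tens_eq s t -> tens_eq t u -> tens_eq s u
| tens_addE s s' t t' : tens_eq s s' -> tens_eq t t' -> tens_eq (TAdd s t) (TAdd s' t')
| tens_oppE s s' : tens_eq s s' -> tens_eq (TOpp s) (TOpp s')
| tens_addA s t u : tens_eq (TAdd s (TAdd t u)) (TAdd (TAdd s t) u)
| tens_addC s t : tens_eq (TAdd s t) (TAdd t s)
| tens_add0 s : tens_eq (TAdd TZero s) s
| tens_addN s : tens_eq (TAdd (TOpp s) s) TZero
| tens_pureDl g h c : tens_eq (TPure (g + h) c) (TAdd (TPure g c) (TPure h c))
| tens_pureDr h c d : tens_eq (TPure h (c + d)) (TAdd (TPure h c) (TPure h d))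
| tens_balanced h a c : A a -> tens_eq (TPure (h * a) c) (TPure h (chi a * c)).

Definition tens_eqb (s t : tens_expr) : bool := `[< tens_eq s t >].

Let tens_eqb_refl : reflexive tens_eqb.
Proof. by move=> s; apply/asboolP; apply: tens_refl. Qed.
Let tens_eqb_sym : symmetric tens_eqb.
Proof. by move=> s t; apply/asboolP/asboolP; apply: tens_sym. Qed.
Let tens_eqb_trans : transitive tens_eqb.
Proof.
by move=> s t u /asboolP st /asboolP su; apply/asboolP; apply: tens_trans st su.
Qed.

Canonical tens_equiv := EquivRel tens_eqb tens_eqb_refl tens_eqb_sym tens_eqb_trans.

Definition induced : Type := {eq_quot tens_equiv}.
HB.instance Definition _ := Choice.on induced.
HB.instance Definition _ : EqQuotient tens_expr tens_equiv induced :=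
  EqQuotient.on induced.

Definition induced_of (s : tens_expr) : induced := \pi_induced s.

Lemma induced_eqP s t : induced_of s = induced_of t <-> tens_eq s t.
Proof.
rewrite /induced_of; split; first by move/eqmodP => /asboolP.
by move=> st; apply/eqmodP/asboolP.
Qed.

Lemma induced_surj x : exists s, x = induced_of s.
Proof. by exists (repr x); rewrite /induced_of reprK. Qed.

Lemma induced_repr s : tens_eq (repr (induced_of s)) s.
Proof. by apply/induced_eqP; rewrite /induced_of reprK. Qed.

Fixpoint tens_scale (g : H) (s : tens_expr) : tens_expr :=
  match s with
  | TZero => TZero
  | TAdd s t => TAdd (tens_scale g s) (tens_scale g t)
  | TOpp s => TOpp (tens_scale g s)
  | TPure h c => TPure (g * h) c
  end.

Lemma tens_scaleE g s t : tens_eq s t -> tens_eq (tens_scale g s) (tens_scale g t).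
Proof.
elim=> {s t} /=.
- by move=> s; apply: tens_refl.
- by move=> s t _; apply: tens_sym.
- by move=> s t u _ IH1 _ IH2; apply: tens_trans IH1 IH2.
- by move=> s s' t t' _ IH1 _ IH2; apply: tens_addE.
- by move=> s s' _ IH; apply: tens_oppE.
- by move=> *; apply: tens_addA.
- by move=> *; apply: tens_addC.
- by move=> *; apply: tens_add0.
- by move=> *; apply: tens_addN.
- by move=> *; rewrite mulrDr; apply: tens_pureDl.
- by move=> *; apply: tens_pureDr.
- by move=> h a c Aa; rewrite mulrA; apply: tens_balanced.
Qed.

Definition iadd (x y : induced) := induced_of (TAdd (repr x) (repr y)).
Definition iopp (x : induced) := induced_of (TOpp (repr x)).
Definition iscale (g : H) (x : induced) := induced_of (tens_scale g (repr x)).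

Lemma induced_addE s t : iadd (induced_of s) (induced_of t) = induced_of (TAdd s t).
Proof. by apply/induced_eqP; apply: tens_addE; exact: induced_repr. Qed.
Lemma induced_oppE s : iopp (induced_of s) = induced_of (TOpp s).
Proof. by apply/induced_eqP; apply: tens_oppE; exact: induced_repr. Qed.
Lemma induced_scaleE g s : iscale g (induced_of s) = induced_of (tens_scale g s).
Proof. by apply/induced_eqP; apply: tens_scaleE; exact: induced_repr. Qed.

Local Ltac lift := repeat (let x := fresh "x" in move=> x; case: (induced_surj x) => {x} ? ->);
  rewrite ?(induced_addE, induced_oppE, induced_scaleE);
  apply/induced_eqP.

Let iaddA : associative iadd. Proof. lift; exact: tens_addA. Qed.
Let iaddC : commutative iadd. Proof. lift; exact: tens_addC. Qed.
Let iadd0 : left_id (induced_of TZero) iadd. Proof. lift; exact: tens_add0. Qed.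
Let iaddN : left_inverse (induced_of TZero) iopp iadd.
Proof. lift; exact: tens_addN. Qed.

HB.instance Definition _ := GRing.isZmodule.Build induced iaddA iaddC iadd0 iaddN.

Let iscaleA g h x : iscale g (iscale h x) = iscale (g * h) x.
Proof.
move: x; lift; match goal with |- tens_eq (tens_scale g (tens_scale h ?s)) _ => elim: s end => /=.
- exact: tens_refl.
- by move=> s IHs t IHt; apply: tens_addE.
- by move=> s IHs; apply: tens_oppE.
- by move=> k c; rewrite mulrA; apply: tens_refl.
Qed.
Let iscale1 : left_id 1 iscale.
Proof.
lift; match goal with |- tens_eq _ ?s => elim: s end => /=.
- exact: tens_refl.
- by move=> s IHs t IHt; apply: tens_addE.
- by move=> s IHs; apply: tens_oppE.
- by move=> k c; rewrite mul1r; apply: tens_refl.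
Qed.
Let iscaleDr : right_distributive iscale +%R.
Proof. by move=> g; rewrite /GRing.add /=; lift; exact: tens_refl. Qed.
Let iscaleDl x : {morph iscale^~ x : g h / g + h}.
Proof.
move=> g h; case: (induced_surj x) => s ->; rewrite !induced_scaleE.
elim: s => [|s IHs t IHt|s IHs|k c].
- by rewrite [RHS]add0r.
- have cE g' u v : induced_of (tens_scale g' (TAdd u v)) =
      induced_of (tens_scale g' u) + induced_of (tens_scale g' v).
    by rewrite /GRing.add /= induced_addE.
  by rewrite !cE IHs IHt addrACA.
- have cE g' u : induced_of (tens_scale g' (TOpp u)) = - induced_of (tens_scale g' u).
    by rewrite /GRing.opp /= induced_oppE.
  by rewrite !cE IHs opprD.
- rewrite /GRing.add /= induced_addE; apply/induced_eqP.
  by rewrite mulrDl; apply: tens_pureDl.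
Qed.

HB.instance Definition _ := GRing.Zmodule_isLmodule.Build H induced
  iscaleA iscale1 iscaleDr iscaleDl.

Definition ind_tensor (h : H) (c : K) : induced := induced_of (TPure h c).

End InducedModule.

(* V has basis v_1, v_2, v_3, indexed by 'I_3 (0, 1, 2); a basis of the n-th
   tensor power (n = m + 2) is indexed by the maps 'I_n -> 'I_3, and a tensor is
   the function giving its coordinates. *)
Notation tindex m := {ffun 'I_m.+2 -> 'I_3}.
Notation tspace K m := {ffun tindex m -> K^o}.

Section Positions.
Variable m : nat.

(* The positions i and i + 1 (1-based) of the generator T_i. *)
Definition pos_lo (i : 'I_m.+1) : 'I_m.+2 := widen_ord (leqnSn _) i.
Definition pos_hi (i : 'I_m.+1) : 'I_m.+2 := lift ord0 i.

Definition upd (alpha : tindex m) (i : 'I_m.+2) (a : 'I_3) : tindex m :=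
  [ffun k => if k == i then a else alpha k].

Lemma pos_lohi i : pos_lo i != pos_hi i.
Proof. by rewrite -val_eqE /= /bump /= add1n neq_ltn ltnSn. Qed.

End Positions.

Section LocalOperators.
Variables (K : fieldType) (m : nat).
Implicit Types (alpha beta : tindex m) (i j : 'I_m.+2) (f : tspace K m).

Definition tbasis (A : finType) (a : A) : {ffun A -> K^o} :=
  [ffun b => (b == a)%:R].

(* X gives the images of the basis vectors of V (resp. of V (x) V).  These are
   X acting at position i, resp. at positions i and j of the tensor power, by
   the matrix action on coordinates: see loc1_basis and loc2_basis. *)
Definition loc1 (X : 'I_3 -> {ffun 'I_3 -> K^o}) i f : tspace K m :=
  [ffun alpha : tindex m => \sum_(a : 'I_3) X a (alpha i) * f (upd alpha i a)].

Definition loc2 (X : 'I_3 * 'I_3 -> {ffun 'I_3 * 'I_3 -> K^o}) i j f : tspace K m :=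
  [ffun alpha : tindex m => \sum_(a : 'I_3 * 'I_3)
     X a (alpha i, alpha j) * f (upd (upd alpha i a.1) j a.2)].

Lemma loc1_linear X i : linear (loc1 X i).
Proof.
move=> c f g; apply/ffunP => al; rewrite !ffunE scaler_sumr -big_split /=.
by apply: eq_bigr => a _; rewrite !ffunE mulrDr [X in X + _]mulrCA.
Qed.

Lemma loc2_linear X i j : linear (loc2 X i j).
Proof.
move=> c f g; apply/ffunP => al; rewrite !ffunE scaler_sumr -big_split /=.
by apply: eq_bigr => a _; rewrite !ffunE mulrDr [X in X + _]mulrCA.
Qed.

Lemma upd_same alpha i : upd alpha i (alpha i) = alpha.
Proof. by apply/ffunP => k; rewrite ffunE; case: eqP => [->|]. Qed.

Lemma loc1_basis X i beta :
  loc1 X i (tbasis beta) = \sum_a X (beta i) a *: tbasis (upd beta i a).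
Proof.
apply/ffunP => al; rewrite ffunE sum_ffunE.
have [e|ne] := eqVneq (upd al i (beta i)) beta.
  rewrite (bigD1 (beta i)) //= ffunE e eqxx mulr1 big1 ?addr0; last first.
    move=> a na; rewrite ffunE; case: eqP => [/ffunP/(_ i)|]; last by rewrite mulr0.
    by rewrite ffunE eqxx => ea; rewrite ea eqxx in na.
  rewrite (bigD1 (al i)) //= big1 ?addr0 => [|a na].
    rewrite !ffunE; have -> : upd beta i (al i) = al.
      apply/ffunP => k; rewrite ffunE; case: eqP => [->//|/eqP nk].
      by rewrite -e ffunE (negPf nk).
    by rewrite eqxx [RHS]mulr1.
  rewrite !ffunE; case: eqP => [/ffunP/(_ i)|]; last by rewrite scaler0.
  by rewrite ffunE eqxx => ea; rewrite ea eqxx in na.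
rewrite big1 => [|a _].
  rewrite big1 // => a _; rewrite !ffunE; case: eqP => [ea|]; last by rewrite scaler0.
  case/eqP: ne; apply/ffunP => k; by rewrite ea !ffunE; case: eqP => [->|].
rewrite ffunE; case: eqP => [ea|]; last by rewrite mulr0.
case/eqP: ne; rewrite -ea; apply/ffunP => k; rewrite !ffunE eqxx.
by case: eqP.
Qed.

Lemma loc2_basis X i j beta : i != j ->
  loc2 X i j (tbasis beta) =
  \sum_a X (beta i, beta j) a *: tbasis (upd (upd beta i a.1) j a.2).
Proof.
move=> nij; have nji : (j == i) = false by rewrite eq_sym (negPf nij).
apply/ffunP => al; rewrite ffunE sum_ffunE.
have updi (g : tindex m) a b : upd (upd g i a) j b i = a.
  by rewrite !ffunE eqxx (negPf nij).
have updj (g : tindex m) a b : upd (upd g i a) j b j = b by rewrite !ffunE eqxx.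
have updk (g : tindex m) a b k : k != i -> k != j -> upd (upd g i a) j b k = g k.
  by move=> ki kj; rewrite !ffunE (negPf ki) (negPf kj).
have [e|ne] := eqVneq (upd (upd al i (beta i)) j (beta j)) beta.
  rewrite (bigD1 (beta i, beta j)) //= ffunE e eqxx mulr1 big1 ?addr0; last first.
    case=> a b na; rewrite ffunE; case: eqP => [/ffunP ea|]; last by rewrite mulr0.
    by rewrite -(ea i) -(ea j) updi updj eqxx in na.
  rewrite (bigD1 (al i, al j)) //= big1 ?addr0 => [|[a b] na].
    rewrite !ffunE; have -> : upd (upd beta i (al i)) j (al j) = al.
      apply/ffunP => k; have [->|ki] := eqVneq k i; first by rewrite updi.
      have [->|kj] := eqVneq k j; first by rewrite updj.
      by rewrite updk // -e updk.
    by rewrite eqxx [RHS]mulr1.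
  rewrite !ffunE; case: eqP => [/ffunP ea|]; last by rewrite scaler0.
  by rewrite (ea i) (ea j) updi updj eqxx in na.
rewrite big1 => [|[a b] _].
  rewrite big1 // => -[a b] _; rewrite !ffunE; case: eqP => [ea|]; last by rewrite scaler0.
  case/eqP: ne; apply/ffunP => k; have [->|ki] := eqVneq k i; first by rewrite updi.
  have [->|kj] := eqVneq k j; first by rewrite updj.
  by rewrite updk // ea updk.
rewrite ffunE; case: eqP => [ea|]; last by rewrite mulr0.
case/eqP: ne; rewrite -ea; apply/ffunP => k; have [->|ki] := eqVneq k i; first by rewrite !updi.
have [->|kj] := eqVneq k j; first by rewrite !updj.
by rewrite [LHS]updk // [RHS]updk.
Qed.

End LocalOperators.

Section SpinOperators.
Variables (K : fieldType) (m : nat) (q : K) (d : 'I_3 -> K).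
Local Notation W := (tspace K m).

(* p(1) = p(2) = 0 and p(3) = 1. *)
Definition parity (a : 'I_3) : bool := (a == 2 :> nat).

Definition bsign (a b : 'I_3) : K := (-1) ^+ (parity a + parity b).

Definition Bmap (x : 'I_3 * 'I_3) : {ffun 'I_3 * 'I_3 -> K^o} :=
  let: (i, j) := x in
  if i == j then (if parity i then - q^-1 else q) *: tbasis K (i, i)
  else if (i < j)%N then
    (q - q^-1) *: tbasis K (i, j) + bsign i j *: tbasis K (j, i)
  else bsign i j *: tbasis K (j, i).

Definition Pmap (x : 'I_3 * 'I_3) : {ffun 'I_3 * 'I_3 -> K^o} := tbasis K (x.2, x.1).

Definition Dmap (a : 'I_3) : {ffun 'I_3 -> K^o} := d a *: tbasis K a.
Definition DVmap (a : 'I_3) : {ffun 'I_3 -> K^o} := (d a)^-1 *: tbasis K a.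

Definition T_op (i : 'I_m.+1) (f : W) : W := loc2 Bmap (pos_lo i) (pos_hi i) f.
Definition P_op (i : 'I_m.+1) (f : W) : W := loc2 Pmap (pos_lo i) (pos_hi i) f.

(* P_{12} o P_{23} o ... o P_{n-1,n} o (D)_n, and its inverse. *)
Definition Z_op : W -> W :=
  foldr (fun i g => P_op i \o g) (loc1 Dmap ord_max) (enum 'I_m.+1).
Definition ZV_op : W -> W :=
  loc1 DVmap ord_max \o foldr (fun i g => g \o P_op i) id (enum 'I_m.+1).

Definition spin_op (x : hecke_gen m) : W -> W :=
  match x with GenT i => T_op i | GenZ => Z_op | GenZV => ZV_op end.

Lemma spin_op_linear x : linear (spin_op x).
Proof.
case: x => [i| |] a u v /=; first exact: loc2_linear.
  rewrite /Z_op; elim: (enum _) => [|i s IH] /=; first exact: loc1_linear.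
  by rewrite IH /P_op loc2_linear.
rewrite /ZV_op /= -loc1_linear; congr loc1.
elim: (enum _) u v => [|i s IH] u v //=.
by rewrite /P_op loc2_linear IH.
Qed.

HB.instance Definition _ x := GRing.isLinear.Build K W W _ _ (spin_op_linear x).

End SpinOperators.

Section SpinRelations.
Variables (K : fieldType) (m : nat) (q : K) (d : 'I_3 -> K).
Hypotheses (q0 : q != 0) (d0 : forall a, d a != 0).
Local Notation W := (tspace K m).
Local Notation T_op := (@T_op K m q).
Local Notation Z_op := (@Z_op K m d).
Local Notation ZV_op := (@ZV_op K m d).
Local Notation P_op := (@P_op K m).

Definition tswap (al : tindex m) (i : 'I_m.+1) : tindex m :=
  [ffun k => al (tperm (pos_lo i) (pos_hi i) k)].

Definition Bdiag (a b : 'I_3) : K :=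
  if a == b then (if parity a then - q^-1 else q)
  else if (a < b)%N then q - q^-1 else 0.
Definition Boff (a b : 'I_3) : K := if a == b then 0 else bsign K a b.

Let ord3 (a : 'I_3) : [\/ a = inord 0, a = inord 1 | a = inord 2].
Proof.
case: a => [[|[|[|a]]] //= h]; [apply: Or31|apply: Or32|apply: Or33];
  by apply/val_inj; rewrite /= inordK.
Qed.

Lemma BmapE x a b :
  Bmap q x (a, b) = Bdiag a b * (x == (a, b))%:R + Boff a b * (x == (b, a))%:R.
Proof.
case: x => i j; rewrite /Bmap /Bdiag /Boff /bsign.
have [->|nij] := eqVneq i j.
  rewrite !ffunE !xpair_eqE; have [<-|nab] := eqVneq a b.
    by rewrite mul0r addr0 andbb andbb (eq_sym j a); have [->|] := eqVneq a j; rewrite ?mulr0 ?scaler0.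
  have -> : (a == j) && (b == j) = false.
    by apply/negbTE/negP => /andP[/eqP aj /eqP bj]; rewrite aj bj eqxx in nab.
  have -> : (j == a) && (j == b) = false.
    by apply/negbTE/negP => /andP[/eqP aj /eqP bj]; rewrite -aj -bj eqxx in nab.
  have -> : (j == b) && (j == a) = false.
    by apply/negbTE/negP => /andP[/eqP aj /eqP bj]; rewrite -aj -bj eqxx in nab.
  by rewrite scaler0 !mulr0 addr0.
have e : (if (i < j)%N
   then (q - q^-1) *: tbasis K (i, j) + (-1) ^+ (parity i + parity j) *: tbasis K (j, i)
   else (-1) ^+ (parity i + parity j) *: tbasis K (j, i)) (a, b) =
   (if (i < j)%N then q - q^-1 else 0) * ((i, j) == (a, b))%:R
   + (-1) ^+ (parity i + parity j) * ((i, j) == (b, a))%:R.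
  rewrite ![(i, j) == _]eq_sym.
  have -> : ((b, a) == (i, j)) = ((a, b) == (j, i)) by rewrite !xpair_eqE andbC.
  by case: ifP => _; rewrite !ffunE ?mul0r ?add0r.
rewrite e; have [E1|_] := eqVneq (i, j) (a, b).
  case: E1 => <- <-; rewrite (negPf nij); congr (_ + _ * _).
have [E2|_] := eqVneq (i, j) (b, a).
  by case: E2 => <- <-; rewrite eq_sym (negPf nij) !mulr0 !add0r addnC.
by rewrite !mulr0.
Qed.

Lemma upd_tswap al (i : 'I_m.+1) :
  upd (upd al (pos_lo i) (al (pos_hi i))) (pos_hi i) (al (pos_lo i)) = tswap al i.
Proof.
apply/ffunP => k; rewrite !ffunE.
have [->|nh] := eqVneq k (pos_hi i); first by rewrite tpermR.
have [->|nl] := eqVneq k (pos_lo i); first by rewrite tpermL.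
by rewrite tpermD // eq_sym.
Qed.

Let upd_id al (i : 'I_m.+1) :
  upd (upd al (pos_lo i) (al (pos_lo i))) (pos_hi i) (al (pos_hi i)) = al.
Proof. by rewrite !upd_same. Qed.

Let sum_delta (F : 'I_3 * 'I_3 -> K) c y : \sum_x c * (x == y)%:R * F x = c * F y.
Proof.
rewrite (bigD1 y) //= eqxx mulr1 big1 ?addr0 // => x /negPf ->.
by rewrite mulr0 mul0r.
Qed.

Lemma T_opE i f al : T_op i f al = 
  Bdiag (al (pos_lo i)) (al (pos_hi i)) * f al
  + Boff (al (pos_lo i)) (al (pos_hi i)) * f (tswap al i).
Proof.
rewrite ffunE; under eq_bigr => x _ do rewrite BmapE mulrDl.
by rewrite big_split /= !sum_delta upd_id upd_tswap.
Qed.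

Lemma P_opE i f al : P_op i f al = f (tswap al i).
Proof.
rewrite ffunE -upd_tswap.
rewrite (bigD1 (al (pos_hi i), al (pos_lo i))) //= ffunE eqxx mul1r big1 ?addr0 //.
move=> [a b] ne; rewrite ffunE /=; case: eqP => [[e1 e2]|]; last by rewrite mul0r.
by rewrite e1 e2 eqxx in ne.
Qed.

Lemma tswap_lo al i : tswap al i (pos_lo i) = al (pos_hi i).
Proof. by rewrite ffunE tpermL. Qed.
Lemma tswap_hi al i : tswap al i (pos_hi i) = al (pos_lo i).
Proof. by rewrite ffunE tpermR. Qed.
Lemma tswap_ne al i k : k != pos_lo i -> k != pos_hi i -> tswap al i k = al k.
Proof. by move=> nl nh; rewrite ffunE tpermD // eq_sym. Qed.
Lemma tswapK al i : tswap (tswap al i) i = al.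
Proof. by apply/ffunP => k; rewrite !ffunE tpermK. Qed.
Lemma tswap_eq (al : tindex m) i : al (pos_lo i) = al (pos_hi i) -> tswap al i = al.
Proof.
move=> e; apply/ffunP => k; have [->|nl] := eqVneq k (pos_lo i); first by rewrite tswap_lo.
by have [->|nh] := eqVneq k (pos_hi i); [rewrite tswap_hi|rewrite tswap_ne].
Qed.

Let braid_pos (i j : 'I_m.+1) : j = i.+1 :> nat ->
  [/\ pos_hi i = pos_lo j, pos_lo i != pos_lo j, pos_lo i != pos_hi j
    & pos_lo j != pos_hi j].
Proof.
move=> e; split; last exact: pos_lohi.
- by apply/val_inj; rewrite /= /bump /= add1n e.
- by rewrite -val_eqE /= e neq_ltn ltnSn.
- by rewrite -val_eqE /= /bump /= add1n e neq_ltn ltnS leqnSn.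
Qed.

Let i01 : (inord 0 == inord 1 :> 'I_3) = false. Proof. by rewrite -val_eqE /= !inordK. Qed.
Let i02 : (inord 0 == inord 2 :> 'I_3) = false. Proof. by rewrite -val_eqE /= !inordK. Qed.
Let i12 : (inord 1 == inord 2 :> 'I_3) = false. Proof. by rewrite -val_eqE /= !inordK. Qed.
Let i10 : (inord 1 == inord 0 :> 'I_3) = false. Proof. by rewrite -val_eqE /= !inordK. Qed.
Let i20 : (inord 2 == inord 0 :> 'I_3) = false. Proof. by rewrite -val_eqE /= !inordK. Qed.
Let i21 : (inord 2 == inord 1 :> 'I_3) = false. Proof. by rewrite -val_eqE /= !inordK. Qed.
Let iE := (i01, i02, i12, i10, i20, i21).

Let tswap_braid (al : tindex m) (i j : 'I_m.+1) : j = i.+1 :> nat ->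
  tswap (tswap (tswap al i) j) i = tswap (tswap (tswap al j) i) j.
Proof.
move=> e; have [e1 n1 n2 n3] := braid_pos e.
apply/ffunP => k; rewrite !ffunE e1.
move: n1 n2 n3; move: (pos_lo i) (pos_lo j) (pos_hi j) => x y z xy xz yz.
congr (al _); have Ey : (y == x) = false by rewrite eq_sym (negPf xy).
have Ez : (z == x) = false by rewrite eq_sym (negPf xz).
have Ezy : (z == y) = false by rewrite eq_sym (negPf yz).
have E := (eqxx, negPf xy, negPf xz, negPf yz, Ey, Ez, Ezy).
have [->|/negPf na] := eqVneq k x; first by rewrite !permE /=; do 5!rewrite ?E /=.
have [->|/negPf nb] := eqVneq k y; first by rewrite !permE /=; do 5!rewrite ?E /=.
have [->|/negPf nc] := eqVneq k z; first by rewrite !permE /=; do 5!rewrite ?E /=.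
by rewrite !permE /=; do 5!rewrite ?(na, nb, nc) /=.
Qed.


Let lt3 (a b : nat) : (a < 3)%N -> (b < 3)%N -> ((inord a : 'I_3) < (inord b : 'I_3))%N = (a < b)%N.
Proof. by move=> ha hb; rewrite !inordK. Qed.
Let par3 (a : nat) : (a < 3)%N -> parity (inord a) = (a == 2)%N.
Proof. by move=> ha; rewrite /parity /= inordK. Qed.

Let tcsE := (iE, eqxx, lt3, par3).

Let T_op_quad i f : T_op i (T_op i f) = (q - q^-1) *: T_op i f + f.
Proof.
apply/ffunP => al; rewrite [RHS]ffunE [X in _ = X + _]ffunE.
rewrite !T_opE tswap_lo tswap_hi tswapK.
set a := al (pos_lo i); set b := al (pos_hi i).
have h : a = b -> tswap al i = al by exact: tswap_eq.
rewrite /GRing.scale /=.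
have [ab|nab] := eqVneq a b.
  rewrite (h ab) ab /Bdiag /Boff eqxx; case: (parity b); move: (f al) => F; field => //.
have nba : (b == a) = false by rewrite eq_sym (negPf nab).
rewrite /Bdiag /Boff nba (negPf nab) /bsign.
move: (f al) (f (tswap al i)) => F G.
have -> : (-1) ^+ (parity a + parity b) = (-1) ^+ (parity b + parity a) :> K by rewrite addnC.
have s2 : (-1) ^+ (parity b + parity a) * (-1) ^+ (parity b + parity a) = 1 :> K.
  by rewrite -expr2 sqrr_sign.
move: s2; set s := _ ^+ _ => s2.
by case: ltngtP nab => [_ _|_ _|/val_inj ->]; [ring: s2|ring: s2|rewrite eqxx].
Qed.

Let T_op_braid (i j : 'I_m.+1) (f : W) : j = i.+1 :> nat ->
  T_op i (T_op j (T_op i f)) = T_op j (T_op i (T_op j f)).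
Proof.
move=> e; have [e1 n1 n2 n3] := braid_pos e.
have n1' : pos_lo j != pos_lo i by rewrite eq_sym.
have n2' : pos_hi j != pos_lo i by rewrite eq_sym.
have n3' : pos_hi j != pos_lo j by rewrite eq_sym.
have sl (al : tindex m) : tswap al i (pos_lo j) = al (pos_lo i) by rewrite -e1 tswap_hi.
have sh (al : tindex m) : tswap al i (pos_hi j) = al (pos_hi j) by rewrite tswap_ne // e1.
have tl (al : tindex m) : tswap al j (pos_lo i) = al (pos_lo i) by rewrite tswap_ne.
apply/ffunP => al; have br := tswap_braid al e.
rewrite !T_opE !e1 !(tswap_lo, tswap_hi, sl, sh, tl, e1) !tswapK br.
have ab : al (pos_lo i) = al (pos_lo j) -> tswap al i = al.
  by move=> h; apply: tswap_eq; rewrite e1.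
have bc : al (pos_lo j) = al (pos_hi j) -> tswap al j = al by exact: tswap_eq.
have ac : al (pos_lo i) = al (pos_hi j) -> tswap (tswap al i) j = tswap al i
    /\ tswap (tswap al j) i = tswap al j.
  move=> h; split; apply: tswap_eq; first by rewrite sl sh.
  by rewrite tl e1 tswap_lo.
have lo2 (g : tindex m) : tswap g i (pos_lo i) = g (pos_lo j) by rewrite tswap_lo e1.
rewrite ?lo2 ?(tswap_lo, tswap_hi, sl, sh, tl).
move: ab bc ac; case: (ord3 (al (pos_lo i))) => ->; case: (ord3 (al (pos_lo j))) => ->;
 case: (ord3 (al (pos_hi j))) => -> => ab bc ac;
 try (rewrite -br (ab erefl)); try rewrite (bc erefl);
 try (have [c1 c2] := ac erefl; rewrite ?c2 ?tswapK ?c1);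
 rewrite /Bdiag /Boff /bsign !tcsE /= ?addn0 ?add0n ?expr0 ?expr1 ?mul0r ?mulr0 ?add0r ?addr0.
all: first [by [] | by field].
Qed.

Let comm_pos (i j : 'I_m.+1) : (i.+1 < j)%N ->
  [/\ pos_lo i != pos_lo j, pos_lo i != pos_hi j,
      pos_hi i != pos_lo j & pos_hi i != pos_hi j].
Proof.
move=> e; split; rewrite -val_eqE /= /bump /= ?add1n; apply/eqP => h; lia.
Qed.

Let T_op_comm0 (i j : 'I_m.+1) (f : W) : (i.+1 < j)%N ->
  T_op i (T_op j f) = T_op j (T_op i f).
Proof.
move=> e; have [n1 n2 n3 n4] := comm_pos e.
have sl (al : tindex m) : tswap al i (pos_lo j) = al (pos_lo j) by rewrite tswap_ne 1?eq_sym.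
have sh (al : tindex m) : tswap al i (pos_hi j) = al (pos_hi j) by rewrite tswap_ne 1?eq_sym.
have tl (al : tindex m) : tswap al j (pos_lo i) = al (pos_lo i) by rewrite tswap_ne.
have th (al : tindex m) : tswap al j (pos_hi i) = al (pos_hi i) by rewrite tswap_ne.
have ss (al : tindex m) : tswap (tswap al j) i = tswap (tswap al i) j.
  apply/ffunP => k; rewrite !ffunE; congr (al _).
  rewrite (inj_tperm _ _ _ (@perm_inj _ (tperm (pos_lo j) (pos_hi j)))).
  by congr (tperm _ _ _); rewrite tpermD // eq_sym.
apply/ffunP => al; rewrite !T_opE sl sh tl th ss; ring.
Qed.

Let T_op_comm (i j : 'I_m.+1) (f : W) : (i.+1 < j)%N || (j.+1 < i)%N ->
  T_op i (T_op j f) = T_op j (T_op i f).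
Proof. by case/orP => e; [apply: T_op_comm0|rewrite (T_op_comm0 _ e)]. Qed.

Definition trot (al : tindex m) : tindex m := [ffun k => al (ordS k)].
Definition trotV (al : tindex m) : tindex m := [ffun k => al (ord_pred k)].

Lemma trotE al k : trot al k = al (ordS k). Proof. by rewrite ffunE. Qed.
Lemma trotK al : trotV (trot al) = al.
Proof. by apply/ffunP => k; rewrite !ffunE ord_predK. Qed.
Lemma trotVK al : trot (trotV al) = al.
Proof. by apply/ffunP => k; rewrite !ffunE ordSK. Qed.

Let foldl_tswap al : foldl tswap al (enum 'I_m.+1) = trot al.
Proof.
have H k : (k <= m.+1)%N -> forall j : 'I_m.+2,
    foldl tswap al (take k (enum 'I_m.+1)) j =
    if (j < k)%N then al (inord j.+1) else if j == k :> nat then al ord0 else al j.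
  elim: k => [|k IH] hk j.
    rewrite take0 /=; case: eqP => // j0; congr (al _); exact/val_inj.
  rewrite (take_nth ord0) ?size_enum_ord // -cats1 foldl_cat /= ffunE.
  have -> : nth ord0 (enum 'I_m.+1) k = Ordinal hk by apply/val_inj; rewrite /= nth_enum_ord.
  set i := Ordinal hk; rewrite {}IH ?(ltnW hk) //.
  have vl : pos_lo i = k :> nat by [].
  have vh : pos_hi i = k.+1 :> nat by rewrite /= /bump /= add1n.
  have [->|nl] := eqVneq j (pos_lo i).
    rewrite tpermL vl vh ltnNge leqnSn /= ltnSn.
    rewrite gtn_eqF //; congr (al _); apply/val_inj.
    by rewrite /= /bump /= add1n inordK //.
  have [->|nh] := eqVneq j (pos_hi i).
    by rewrite tpermR vl vh !ltnn !eqxx.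
  rewrite tpermD 1?eq_sym //.
  have jl : (j == k :> nat) = false := negbTE nl.
  have jh : (j == k.+1 :> nat) = false by rewrite -vh; exact: negbTE nh.
  by rewrite ltnS [(j <= k)%N]leq_eqVlt jl jh (eq_sym k) jl.
apply/ffunP => j; have := H m.+1 (leqnn _) j.
rewrite take_oversize ?size_enum_ord // => ->; rewrite ffunE.
have [jm|jm] := ltnP j m.+1.
  by congr (al _); apply/val_inj; rewrite /= inordK // modn_small.
have jE : j = m.+1 :> nat by apply/eqP; rewrite eqn_leq jm -ltnS ltn_ord.
by rewrite jE eqxx; congr (al _); apply/val_inj; rewrite /= jE modnn.
Qed.

Let foldr_tswap al : foldr (fun i b => tswap b i) al (enum 'I_m.+1) = trotV al.
Proof.
have H b s : foldr (fun i b => tswap b i) (foldl tswap b s) s = b.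
  by elim: s b => //= i s IH b; rewrite IH tswapK.
by rewrite -{1}(trotVK al) -foldl_tswap H.
Qed.

Lemma loc1_diag (c : 'I_3 -> K) i f (al : tindex m) :
  loc1 (fun a => c a *: tbasis K a) i f al = c (al i) * f al.
Proof.
rewrite ffunE (bigD1 (al i)) //= big1 ?addr0 => [|a na].
  by rewrite !ffunE eqxx upd_same [_ *: _]mulr1.
by rewrite !ffunE eq_sym (negPf na) scaler0 mul0r.
Qed.

Lemma Z_opE f al : Z_op f al = d (al ord0) * f (trot al).
Proof.
have H h s b : foldr (fun i g => P_op i \o g) h s f b = h f (foldl tswap b s).
  by elim: s b => //= i s IH b; rewrite P_opE IH.
rewrite /Z_op H foldl_tswap loc1_diag ffunE; congr (d (al _) * _).
by apply/val_inj; rewrite /= modnn.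
Qed.

Lemma ZV_opE f al : ZV_op f al = (d (al ord_max))^-1 * f (trotV al).
Proof.
have H s g b : foldr (fun i g => g \o P_op i) id s g b = g (foldr (fun i b => tswap b i) b s).
  by elim: s g b => //= i s IH g b; rewrite IH P_opE.
by rewrite /ZV_op /= loc1_diag H foldr_tswap.
Qed.

Lemma Z_opK f : Z_op (ZV_op f) = f.
Proof.
apply/ffunP => al; rewrite Z_opE ZV_opE trotK ffunE.
have -> : ordS ord_max = ord0 :> 'I_m.+2 by apply/val_inj; rewrite /= modnn.
by rewrite mulrA mulfV // mul1r.
Qed.

Lemma ZV_opK f : ZV_op (Z_op f) = f.
Proof.
apply/ffunP => al; rewrite ZV_opE Z_opE trotVK ffunE.
have -> : ord_pred ord0 = ord_max :> 'I_m.+2.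
  by apply/val_inj; rewrite /= modn_small.
by rewrite mulrA mulVf // mul1r.
Qed.

Let trot_tswap al i j : ordS (pos_lo i) = pos_lo j -> ordS (pos_hi i) = pos_hi j ->
  tswap (trot al) i = trot (tswap al j).
Proof.
move=> el eh; apply/ffunP => k; rewrite !ffunE; congr (al _).
by rewrite inj_tperm ?el ?eh //; exact: ordS_inj.
Qed.

Let Z_op_T (i j : 'I_m.+1) (f : W) : j = i.+1 :> nat -> Z_op (T_op i f) = T_op j (Z_op f).
Proof.
move=> e.
have el : ordS (pos_lo i) = pos_lo j.
  by apply/val_inj; rewrite /= e modn_small // ltnS ltn_ord.
have eh : ordS (pos_hi i) = pos_hi j.
  apply/val_inj; rewrite /= /bump /= !add1n e modn_small // -e ltnS.
  by have := ltn_ord j.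
apply/ffunP => al; rewrite Z_opE !T_opE !Z_opE (trot_tswap al el eh).
rewrite ![trot al _]ffunE el eh tswap_ne; first ring.
  by rewrite -val_eqE /= e.
by rewrite -val_eqE.
Qed.

Let Z_op_Z_op_T f : Z_op (Z_op (T_op ord_max f)) = T_op ord0 (Z_op (Z_op f)).
Proof.
have el : ordS (ordS (pos_lo (ord_max : 'I_m.+1))) = pos_lo ord0.
  by apply/val_inj; rewrite /= [in X in (X.+1)]modn_small // modnn.
have eh : ordS (ordS (pos_hi (ord_max : 'I_m.+1))) = pos_hi ord0.
  by apply/val_inj; rewrite /= /bump /= !add1n modnn modn_small.
have e01 : ordS (ord0 : 'I_m.+2) = pos_hi ord0.
  by apply/val_inj; rewrite /= /bump /= modn_small.
have l0 : pos_lo (ord0 : 'I_m.+1) = ord0 by apply/val_inj.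
have rs (al : tindex m) : tswap (trot (trot al)) ord_max = trot (trot (tswap al ord0)).
  apply/ffunP => k; rewrite !ffunE; congr (al _).
  by rewrite !inj_tperm ?el ?eh //; exact: ordS_inj.
apply/ffunP => al; rewrite !Z_opE !T_opE !Z_opE rs.
have sw0 : tswap al ord0 ord0 = al (pos_hi ord0) by rewrite -{1}l0 tswap_lo.
rewrite !trotE el eh e01 sw0 tswap_hi l0; ring.
Qed.

Lemma spin_op_rels s t : hecke_rel q s t ->
  expr_act (fun x => spin_op q d x : {linear W -> W}) s
  =1 expr_act (fun x => spin_op q d x : {linear W -> W}) t.
Proof.
case=> {s t} /=.
- by move=> i j e w; apply: T_op_braid.
- by move=> i j e w; apply: T_op_comm.
- move=> i w.
  change (T_op i (T_op i w + q^-1 *: w) + - q *: (T_op i w + q^-1 *: w) = 0 *: w).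
  have lin u v : T_op i (u + q^-1 *: v) = T_op i u + q^-1 *: T_op i v.
    rewrite addrC [RHS]addrC; exact: (loc2_linear (Bmap q) (pos_lo i) (pos_hi i) q^-1 v u).
  rewrite lin T_op_quad scale0r; move: (T_op i w) => g; apply/ffunP => al; rewrite !ffunE /GRing.scale /=.
  by field.
- by move=> w; rewrite scale1r Z_opK.
- by move=> w; rewrite scale1r ZV_opK.
- by move=> i j e w; apply: Z_op_T.
- by move=> w; apply: Z_op_Z_op_T.
Qed.

End SpinRelations.

Section SymmetricGroup.
Variable m : nat.
Local Notation S_n := 'S_m.+2.
Local Open Scope group_scope.

Definition simple_refl (i : 'I_m.+1) : S_n := tperm (pos_lo i) (pos_hi i).

(* Composition of permutations as functions; the group law of 'S_n composes in
   the opposite order. *)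
Definition pcomp (u w : S_n) : S_n := w * u.

(* s_{i_1} o ... o s_{i_l}, the composite of functions. *)
Definition word_perm (s : seq 'I_m.+1) : S_n :=
  foldr (fun i w => pcomp (simple_refl i) w) 1 s.

Lemma pcompE u w k : pcomp u w k = u (w k).
Proof. by rewrite permM. Qed.

Lemma word_perm_cat s t : word_perm (s ++ t) = pcomp (word_perm s) (word_perm t).
Proof.
by elim: s => [|i s IH] /=; rewrite /pcomp ?mulg1 // IH /pcomp mulgA.
Qed.

Lemma word_perm_ex (w : S_n) :
  exists k, [exists t : k.-tuple 'I_m.+1, word_perm t == w].
Proof.
suff [s <-] : exists s, word_perm s = w.
  by exists (size s); apply/existsP; exists (in_tuple s).
have tp k : forall a b : 'I_m.+2, (a < b)%N -> (b - a <= k)%N ->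
    exists s, word_perm s = tperm a b.
  elim: k => [|k IH] a b ab bak; first by move: bak; rewrite leqn0 subn_eq0 leqNgt ab.
  have am : (a < m.+1)%N by rewrite -ltnS (leq_trans _ (ltn_ord b)).
  pose i := Ordinal am; have li : pos_lo i = a by apply/val_inj.
  have hi : pos_hi i = a.+1 :> nat by rewrite /= /bump /= add1n.
  have [e|ne] := eqVneq (pos_hi i) b.
    by exists [:: i]; rewrite /= /pcomp mul1g /simple_refl li e.
  have hb : (pos_hi i < b)%N by rewrite hi ltn_neqAle ab andbT -hi; apply: contra_neq ne => /val_inj.
  have [|s hs] := IH _ _ hb; first by rewrite hi; lia.
  exists (i :: s ++ [:: i]); rewrite /= word_perm_cat /pcomp hs /= /pcomp mul1g /simple_refl li.
  have ab' : a != b by rewrite -val_eqE neq_ltn ab.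
  have ah : a != pos_hi i by rewrite -li pos_lohi.
  rewrite -{1}(tpermV a (pos_hi i)) -mulgA -conjgE tpermJ tpermR tpermD //.
have tp' a b : exists s, word_perm s = tperm a b.
  case: (ltngtP a b) => [ab|ba|/val_inj ->]; first exact: tp ab (leqnn _).
    by rewrite tpermC; apply: tp ba (leqnn _).
  by exists [::]; rewrite tperm1.
case: (prod_tpermP w) => ts -> _; elim: ts => [|x ts [s IH]].
  by exists [::]; rewrite big_nil.
case: (tp' x.1 x.2) => s' hs'; exists (s ++ s').
by rewrite big_cons word_perm_cat IH hs' /pcomp.
Qed.

Definition perm_length (w : S_n) : nat := ex_minn (word_perm_ex w).

Definition reduced_word (w : S_n) (s : seq 'I_m.+1) : Prop :=
  word_perm s = w /\ size s = perm_length w.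

Definition min_coset_reps (I : {set 'I_m.+1}) : {set S_n} :=
  [set w | [forall i in I,
     perm_length (pcomp w (simple_refl i)) == (perm_length w).+1]].

Definition perm_act (w : S_n) (alpha : tindex m) : tindex m :=
  [ffun i => alpha (w^-1 i)].

End SymmetricGroup.

Section ParabolicModule.
Variables (R : realType) (p : R) (m : nat) (kappa : R[i]).
Local Notation C := R[i].

Definition cexp (z : C) : C :=
  let: (a +i* b)%C := z in (expR a * cos b +i* (expR a * sin b))%C.

(* p ^ a := exp (a log p) *)
Definition cpow (a : C) : C := cexp (a * (ln p)%:C%C).

Lemma cpow_neq0 a : cpow a != 0.
Proof.
rewrite /cpow; case: (_ * _) => x y; apply/eqP => -[/eqP + /eqP].
rewrite !mulf_eq0 (gt_eqF (expR_gt0 x)) /= => /eqP c0 /eqP s0.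
by have := cos2Dsin2 y; rewrite c0 s0 expr0n /= addr0 => /eqP; rewrite eq_sym oner_eq0.
Qed.

Definition hecke_param : C := cpow (- kappa).
Local Notation q := hecke_param.
Local Notation H := (hecke m q).

Definition sgnz (b : bool) : int := (-1) ^+ b.

(* H_I(q): the smallest subalgebra containing the T_i, i in I, and the Y_j^{+-1}. *)
Definition hecke_sub (I : {set 'I_m.+1}) : set H :=
  smallest (fun B : set H => GRing.subalg_closed (mem B))
    ([set heT q i | i in [set` I]] `|` range (@heY _ m q) `|` range (@heYV _ m q))%classic.

(* Only the values of chi on A matter. *)
Definition linear_character (A : set H) (chi : H -> C) : Prop :=
  [/\ chi 1 = 1,
      {in A &, {morph chi : a b / a + b}},
      {in A &, {morph chi : a b / a * b}}
    & forall c, {in A, forall a, chi (c *: a) = c * chi a}].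

(* Signs: eps i = true stands for -1. *)
Definition E_space (I : {set 'I_m.+1}) (eps : 'I_m.+1 -> bool)
    (gamma : 'I_m.+2 -> C) : Prop :=
  forall i, i \in I ->
    gamma (pos_lo i) - gamma (pos_hi i) = 2 * (sgnz (eps i))%:~R * kappa.

Definition is_principal_char (I : {set 'I_m.+1}) (eps : 'I_m.+1 -> bool)
    (gamma : 'I_m.+2 -> C) (chi : H -> C) : Prop :=
  [/\ linear_character (hecke_sub I) chi,
      forall i, i \in I -> chi (heT q i) = (sgnz (eps i))%:~R * q ^ sgnz (eps i)
    & forall j, chi (heY q j) = cpow (- gamma j)].

(* The unique such character of H_I(q), extended arbitrarily to H_n(q): two of
   them agree on H_I(q), as they agree on its generators. *)
Definition principal_char (I : {set 'I_m.+1}) (eps : 'I_m.+1 -> bool)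
    (gamma : 'I_m.+2 -> C) : H -> C :=
  xget (fun=> 0) [set chi | is_principal_char I eps gamma chi].

Definition principal_series (I : {set 'I_m.+1}) (eps : 'I_m.+1 -> bool)
    (gamma : 'I_m.+2 -> C) : lmodType H :=
  induced (hecke_sub I) (principal_char I eps gamma).

Definition cyclic_vector (I : {set 'I_m.+1}) (eps : 'I_m.+1 -> bool)
    (gamma : 'I_m.+2 -> C) : principal_series I eps gamma :=
  ind_tensor (hecke_sub I) (principal_char I eps gamma) 1 1.

Definition heT_word (s : seq 'I_m.+1) : H := \prod_(i <- s) heT q i.

End ParabolicModule.

(* The basis indices 1, 2, 3 of V. *)
Definition ix1 : 'I_3 := Ordinal (isT : 0 < 3)%N.
Definition ix2 : 'I_3 := Ordinal (isT : 1 < 3)%N.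
Definition ix3 : 'I_3 := Ordinal (isT : 2 < 3)%N.

(* The tensor power of V, carrying the H_n(q)-module structure that depends on
   p, kappa and phi. *)
Definition spin_module (R : realType) (p : R) (m : nat) (kappa : R[i])
  (phi : 'rV[R[i]]_3) : Type := tspace R[i] m.

Section SpinModule.
Variables (R : realType) (p : R) (m : nat) (kappa : R[i]) (phi : 'rV[R[i]]_3).
Local Notation C := R[i].
Local Notation q := (hecke_param p kappa).
Local Notation H := (hecke m q).

Definition spin_twist (a : 'I_3) : C := cpow p (- phi 0 a).

Local Notation spin_module := (spin_module p m kappa phi).
HB.instance Definition _ := GRing.Zmodule.on spin_module.

Definition spin_rep : H -> spin_module -> spin_module :=
  @presented_act C (hecke_gen m) (@hecke_rel C m q) (tspace C m)
    (fun x => spin_op q spin_twist x : {linear tspace C m -> tspace C m}).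

Let ok := @spin_op_rels C m q spin_twist (cpow_neq0 p (- kappa))
  (fun a => cpow_neq0 p (- phi 0 a)).

HB.instance Definition _ := GRing.Zmodule_isLmodule.Build H spin_module
  (presented_actA ok) (presented_act1 ok)
  (presented_actDr _)
  (presented_actDl ok).

Lemma spin_heT i (x : spin_module) : heT q i *: x = T_op q i x.
Proof. exact: (presented_actE ok). Qed.
Lemma spin_heZ (x : spin_module) : heZ m q *: x = Z_op spin_twist x.
Proof. exact: (presented_actE ok). Qed.
Lemma spin_heZV (x : spin_module) : heZV m q *: x = ZV_op spin_twist x.
Proof. exact: (presented_actE ok). Qed.
Lemma spin_scale (c : C) (x : spin_module) :
  (c *: (1 : H)) *: x = (c *: (x : tspace C m) : spin_module).
Proof. exact: (presented_actZ ok). Qed.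

Definition vtensor (alpha : tindex m) : tspace C m := tbasis C alpha.

(* K_n[r], with r_1, r_2, r_3 written r ix1, r ix2, r ix3. *)
Definition weight_indices (r : 'I_3 -> nat) : {set tindex m} :=
  [set alpha : tindex m | [forall j, #|[set i | alpha i == j]| == r j]].

Variable r : 'I_3 -> nat.

Definition weight_vspace : {vspace tspace C m} :=
  <<[seq vtensor alpha | alpha in weight_indices r]>>%VS.

Definition weight_pred : {pred spin_module} :=
  fun x => (x : tspace C m) \in weight_vspace.

Lemma weight_vspaceP (x : tspace C m) :
  reflect (forall al, al \notin weight_indices r -> x al = 0) (x \in weight_vspace).
Proof.
apply: (iffP idP) => [xS al nal|x0].
  rewrite (coord_span xS) sum_ffunE big1 // => i _.
  have : (image_tuple vtensor (weight_indices r))`_i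
      \in [seq vtensor alpha | alpha in weight_indices r].
    by rewrite mem_nth // size_tuple.
  case/mapP => be; rewrite mem_enum => bK ->; rewrite !ffunE; case: eqP => [e|]; last by rewrite scaler0.
  by rewrite e bK in nal.
have -> : x = \sum_(al in weight_indices r) x al *: vtensor al.
  apply/ffunP => al; rewrite sum_ffunE; case: (boolP (al \in weight_indices r)) => alK.
    rewrite (bigD1 al) //= big1 ?addr0 => [|be /andP[_ ne]].
      by rewrite !ffunE eqxx [_ *: _]mulr1.
    by rewrite !ffunE eq_sym (negPf ne) scaler0.
  rewrite x0 // big1 // => be bK; rewrite !ffunE; case: eqP => [e|]; last by rewrite scaler0.
  by rewrite e bK in alK.
apply: rpred_sum => al aK; apply: rpredZ; apply: memv_span.
by apply/mapP; exists al; rewrite ?mem_enum.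
Qed.

Lemma weight_indices_comp (f : 'I_m.+2 -> 'I_m.+2) (al : tindex m) : injective f ->
  ([ffun k => al (f k)] \in weight_indices r) = (al \in weight_indices r).
Proof.
move=> fI; rewrite !inE; apply: eq_forallb => j; congr (_ == _).
rewrite -(card_imset _ fI); apply: eq_card => k; rewrite !inE.
apply/imsetP/idP => [[l]|e]; first by rewrite inE ffunE => h ->.
by exists (invF fI k); rewrite ?inE ?ffunE f_invF.
Qed.

Lemma weight_act (h : H) (x : spin_module) : x \in weight_pred -> h *: x \in weight_pred.
Proof.
have subZ (c : C) (y : tspace C m) : y \in weight_vspace -> c *: y \in weight_vspace.
  exact: rpredZ.
rewrite -[h *: x]/(spin_rep h x) /spin_rep /presented_act.
elim: (repr h) x => [g|c|s IHs t IHt|s IHs t IHt] x xS /=.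
- move: xS; rewrite !unfold_in => /weight_vspaceP x0; apply/weight_vspaceP => al nal.
  case: g => [i| |] /=.
  + rewrite T_opE x0 // x0 ?mulr0 ?addr0 //.
    by rewrite weight_indices_comp //; exact: perm_inj.
  + by rewrite Z_opE x0 ?mulr0 // weight_indices_comp //; exact: ordS_inj.
  + by rewrite ZV_opE x0 ?mulr0 // weight_indices_comp //; exact: ord_pred_inj.
- exact: subZ.
- by apply: (@rpredD _ weight_vspace); [apply: IHs|apply: IHt].
- exact/IHs/IHt.
Qed.

Lemma weight_submod_closed : GRing.subsemimod_closed weight_pred.
Proof.
split; last by move=> h x; apply: weight_act.
split; first exact: (@rpred0 _ weight_vspace).
by move=> x y; apply: (@rpredD _ weight_vspace).
Qed.

HB.instance Definition _ :=
  GRing.isSubmodClosed.Build H spin_module weight_pred weight_submod_closed.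

Record weight_space : Type :=
  WeightSpace { weight_val : spin_module; _ : weight_val \in weight_pred }.
HB.instance Definition _ := [isSub for weight_val].
HB.instance Definition _ := [Choice of weight_space by <:].
HB.instance Definition _ := [SubChoice_isSubLmodule of weight_space by <:].

Definition alpha_r : tindex m :=
  [ffun i : 'I_m.+2 => if (i < r ix3)%N then ix3
                       else if (i < r ix3 + r ix2)%N then ix2 else ix1].

(* The generator T_i of the index set has 1-based index i.+1. *)
Definition I_r : {set 'I_m.+1} :=
  [set i : 'I_m.+1 | (i.+1 != r ix3) && (i.+1 != r ix2 + r ix3)]%N.

Definition eps_r (i : 'I_m.+1) : bool := (i.+1 < r ix3)%N.

Local Notation piI_logp := ((0 +i* trigo.pi)%C / (ln p)%:C%C : C).

Definition eta1 : C := - (piI_logp * (r ix3)%:R) + (r ix1).+1%:R * kappa.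
Definition eta2 : C := - (piI_logp * (r ix3)%:R) + (r ix2).+1%:R * kappa.
Definition eta3 : C := - (piI_logp * m.+1%:R) - (r ix3).+1%:R * kappa.

(* i.+1 is the 1-based index, and n - 1 = m.+1 in eta3. *)
Definition gamma_r (i : 'I_m.+2) : C :=
  if (i < r ix3)%N then eta3 + phi 0 ix3 + 2 * i.+1%:R * kappa
  else if (i < r ix3 + r ix2)%N then
    eta2 + phi 0 ix2 - 2 * (i.+1%:R - (r ix3)%:R) * kappa
  else eta1 + phi 0 ix1 - 2 * (i.+1%:R - (r ix2)%:R - (r ix3)%:R) * kappa.

Lemma gamma_r_E : E_space kappa I_r eps_r gamma_r.
Proof.
move=> i; rewrite inE /gamma_r /eps_r /sgnz => /andP[n1 n2].
have lE : pos_lo i = i :> nat by [].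
have hE : pos_hi i = i.+1 :> nat by rewrite /= /bump /= add1n.
rewrite lE hE; have [i3|i3] := ltnP i.+1 (r ix3).
  by rewrite (ltn_trans _ i3) // expr1 -[i.+2]addn1 natrD; ring.
have -> : (i < r ix3)%N = false by lia.
rewrite expr0; have [i2|i2] := ltnP i.+1 (r ix3 + r ix2).
  have -> : (i < r ix3 + r ix2)%N by lia.
  by rewrite -[i.+2]addn1 natrD; ring.
have -> : (i < r ix3 + r ix2)%N = false by lia.
by rewrite -[i.+2]addn1 natrD; ring.
Qed.

Definition principal_series_r : lmodType H :=
  principal_series p kappa I_r eps_r gamma_r.
Definition cyclic_vector_r : principal_series_r :=
  cyclic_vector p kappa I_r eps_r gamma_r.

Definition sign_exponent (w : 'S_m.+2) : nat :=
  #|[set ij : 'I_m.+2 * 'I_m.+2 | (ij.2 < r ix3 <= ij.1)%N && (w ij.1 < w ij.2)%N]|.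

End SpinModule.

(* P holds outside a countable union of zero sets of nonzero entire functions
   of the parameters (kappa, phi) in C x C^3. *)
Definition generic_parameters (R : realType)
    (P : R[i] -> 'rV[R[i]]_3 -> Prop) : Prop :=
  exists F : nat -> R[i]^o * 'rV[R[i]]_3 -> R[i]^o,
    (forall k, (forall z, differentiable (F k) z) /\ exists z, F k z != 0) /\
    forall kappa phi, (forall k, F k (kappa, phi) != 0) -> P kappa phi.

(* Main.v *)
(* The tensor v_alpha = v_3^r3 (x) v_2^r2 (x) v_1^r1 is a common eigenvector of
   the T_i (i in I) and of the Y_j, with the eigenvalues prescribed by gamma, so
   that it carries the character chi and induces psi.  Since
   T_i v_b = +- v_(s_i b) whenever b_i > b_(i+1), psi is onto.  For injectivity,
   lift v_b to x_b in the principal series along the same moves from alpha; the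
   braid relations make x_b independent of the path (diamond lemma).  The span
   of the x_b is stable under T_i, and under zeta because
   zeta T_(n-1) ... T_j v = T_1 ... T_(j-1) Y_j v, hence it is everything, and
   psi maps the family x_b to a basis.  The formula for psi (v_w) follows by
   building w from a reduced word, every step of which moves a larger letter past
   a smaller one because w is a minimal coset representative. *)
Require Import Defs.
From HB Require Import structures.
From mathcomp Require Import all_boot all_order all_fingroup all_algebra.
From mathcomp Require Import complex.
From mathcomp Require Import all_classical all_reals all_analysis.
From mathcomp Require Import ring zify.

Set Implicit Arguments.
Unset Strict Implicit.
Unset Printing Implicit Defensive.

Import Order.TTheory GRing.Theory Num.Theory.
Local Open Scope ring_scope.

(** The induced module is a quotient by a congruence, so neither its dimension nor a basis is known
    in advance. The lifts [x be] are indexed by the same set as the basis tensors of the target, and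
    sending a tensor to the combination of the [x be] with its coordinates is an explicit section of
    [psi]; this takes the place of a dimension count. The same section yields stability of the span
    under the inverse of zeta. The character is a choice with a default value, so its existence has
    to be proved: it is read off as the coefficient of the eigenvector v_alpha. Straightening
    terminates because each exchange of an ascent lowers a weighted sum of the letters, and an index
    without ascents is alpha, the only weakly decreasing one of its weight. For distinct letters the
    exchange coefficient is a sign, hence its own inverse. These signs are also the origin of pi
    sqrt(-1) / log p in gamma, since p raised to that exponent is -1. *)

(** * Inversions of permutations and the length function *)

Section Inversions.
Variable m : nat.
Local Notation pcomp := Defs.pcomp.
Implicit Types (w : 'S_m.+2) (i : 'I_m.+1) (P : rel 'I_m.+2).

Lemma pos_hiE i : pos_hi i = i.+1 :> nat.
Proof. by []. Qed.

(** No position lies strictly between two adjacent ones, so exchanging them can reverse only their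
    own pair. *)
Lemma simple_refl_ltn i (x y : 'I_m.+2) :
  (x, y) != (pos_lo i, pos_hi i) -> (x, y) != (pos_hi i, pos_lo i) ->
  (simple_refl i x < simple_refl i y)%N = (x < y)%N.
Proof.
rewrite !xpair_eqE -!val_eqE /simple_refl => n1 n2.
by case: tpermP n1 n2 => [->|->|/eqP + /eqP +]; case: tpermP => [->|->|/eqP + /eqP +];
  rewrite -?val_eqE /= /bump /= ?add1n; lia.
Qed.

(* [sign_exponent r] is the case P a b := (a < r ix3 <= b). *)
Definition pair_inversions P w : nat :=
  #|[set ij : 'I_m.+2 * 'I_m.+2 | P ij.2 ij.1 && (w ij.1 < w ij.2)%N]|.

(** Only the pair of preimages [c], [d] of the two exchanged values changes its status. Both [P d c]
    and [P c d] are added, so that neither the order of [c] and [d] nor truncated subtraction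
    enters. *)
Lemma pair_inversions_simple P w i :
  let c := (w^-1)%g (pos_lo i) in let d := (w^-1)%g (pos_hi i) in
  (pair_inversions P (pcomp (simple_refl i) w) + P d c
   = pair_inversions P w + P c d)%N.
Proof.
move=> c d; have cE : w c = pos_lo i by rewrite permKV.
have dE : w d = pos_hi i by rewrite permKV.
have ncd : c != d by apply: contra_neq (pos_lohi i) => e; rewrite -cE -dE e.
have sumE (Q : pred ('I_m.+2 * 'I_m.+2)) : #|[set x | Q x]|
    = (Q (d, c) + Q (c, d) + \sum_(x | (x != (d, c)) && (x != (c, d))) Q x)%N.
  rewrite -sum1dep_card big_mkcond (bigD1 (d, c)) //= (bigD1 (c, d)) /=; last first.
    by rewrite xpair_eqE (negPf ncd).
  by rewrite addnA.
rewrite /pair_inversions !sumE /= !pcompE cE dE.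
rewrite /simple_refl tpermL tpermR pos_hiE [pos_lo i : nat]/= ltnSn ltnNge leqnSn /=.
rewrite !andbT !andbF.
under eq_bigr => ab /andP[n1 n2].
  rewrite !pcompE simple_refl_ltn; first over.
  - by case: ab n1 n2 => a b /= n1 n2; rewrite -cE -dE xpair_eqE !(inj_eq perm_inj) -xpair_eqE.
  - by case: ab n1 n2 => a b /= n1 n2; rewrite -cE -dE xpair_eqE !(inj_eq perm_inj) -xpair_eqE.
move: (\sum_(_ | _) _)%N (nat_of_bool (P c d)) (nat_of_bool (P d c)); lia.
Qed.

Definition inversions w := pair_inversions (fun a b => a < b)%N w.

(** The second conjunct guarantees that [.-1] in the first is a genuine predecessor. *)
Lemma inversions_simple w i :
  inversions (pcomp (simple_refl i) w) =
  (if ((w^-1)%g (pos_lo i) < (w^-1)%g (pos_hi i))%N then (inversions w).+1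
   else (inversions w).-1) /\
  ((w^-1)%g (pos_hi i) < (w^-1)%g (pos_lo i) -> 0 < inversions w)%N.
Proof.
have := @pair_inversions_simple (fun a b => a < b)%N w i.
rewrite /= -/(inversions _) -/(inversions _).
case: ltngtP => [||/val_inj/perm_inj e]; try lia.
by have := pos_lohi i; rewrite e eqxx.
Qed.

Lemma inversionsV w : inversions (w^-1)%g = inversions w.
Proof.
pose f (ij : 'I_m.+2 * 'I_m.+2) := (w ij.2, w ij.1).
have fI : injective f by move=> [a b] [c d] [/perm_inj -> /perm_inj ->].
rewrite /inversions /pair_inversions -[RHS](card_imset _ fI); apply: eq_card => -[a b].
rewrite !inE /=; apply/idP/imsetP => [h|[[c d]]].
  exists ((w^-1)%g b, (w^-1)%g a); last by rewrite /f /= !permKV.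
  by rewrite inE /= !permKV andbC.
by rewrite inE /= => h [-> ->]; rewrite !permK andbC.
Qed.

(** Climbing from the left gives [x <= w x], descending from the right gives [w x <= x]. *)
Lemma perm_mono_id w : (forall i, w (pos_lo i) < w (pos_hi i))%N -> w = 1%g.
Proof.
move=> wm; have ge k : forall x : 'I_m.+2, x = k :> nat -> (k <= w x)%N.
  elim: k => // k IH x xk.
  have km : (k < m.+1)%N by rewrite -ltnS -xk.
  have -> : x = pos_hi (Ordinal km) by apply/val_inj.
  by apply: leq_ltn_trans (wm _); apply: IH.
have le k : forall x : 'I_m.+2, (x + k = m.+1)%N -> (w x <= x)%N.
  elim: k => [|k IH] x xk; first by have := ltn_ord (w x); lia.
  have km : (x < m.+1)%N by lia.
  have xE : x = pos_lo (Ordinal km) by apply/val_inj.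
  rewrite -ltnS {1}xE (leq_trans (wm _)) //.
  by apply: (leq_trans (IH _ _)) => //=; rewrite /bump /= add1n addSnnS.
apply/permP => x; rewrite perm1; apply/val_inj/eqP; rewrite eqn_leq ge // andbT.
by apply: (le (m.+1 - x)%N); have := ltn_ord x; lia.
Qed.

Lemma inversions_word (s : seq 'I_m.+1) : (inversions (word_perm s) <= size s)%N.
Proof.
elim: s => [|i s IH] /=.
  rewrite /inversions /pair_inversions leqn0 cards_eq0; apply/eqP/setP => -[a b].
  by rewrite !inE /= !perm1; case: ltngtP.
by have [-> _] := inversions_simple (word_perm s) i; case: ifP; lia.
Qed.

(** Each letter of a word creates at most one inversion, so no word is shorter than the number of
    inversions. Conversely a descent of the inverse permutation lets one simple reflection be split
    off, removing exactly one inversion; without such a descent the permutation is the identity. *)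
Lemma perm_lengthE w : perm_length w = inversions w.
Proof.
have ex k : forall w, inversions w = k -> exists s, word_perm s = w /\ size s = k.
  elim: k => [|k IH] {}w wk.
    exists [::]; split => //=; apply/esym/invg_inj; rewrite invg1; apply: perm_mono_id => i.
    have [_ h] := inversions_simple w i; case: ltngtP h => // [_|]; rewrite ?wk //.
      by move/(_ isT).
    by move/val_inj/perm_inj => e; have := pos_lohi i; rewrite e eqxx.
  have [i wi|/= wi] := pickP (fun i => (w^-1)%g (pos_hi i) < (w^-1)%g (pos_lo i))%N.
    have [e _] := inversions_simple w i.
    have {}e : inversions (pcomp (simple_refl i) w) = k.
      by rewrite e ltnNge (ltnW wi) /= wk.
    have [s [sw sk]] := IH _ e; exists (i :: s); split; rewrite /= ?sk // sw.
    by apply/permP => x; rewrite !pcompE /simple_refl tpermK.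
  have : (w^-1)%g = 1%g.
    apply: perm_mono_id => i; have := wi i; case: ltngtP => // /val_inj/perm_inj e _.
    by have := pos_lohi i; rewrite e eqxx.
  move/(congr1 inversions); rewrite inversionsV wk => e.
  by have := inversions_word [::]; rewrite /= -e.
rewrite /perm_length; case: ex_minnP => k /existsP[t /eqP tw] kmin.
apply/eqP; rewrite eqn_leq; apply/andP; split; last first.
  by rewrite -tw -[k in (_ <= k)%N](size_tuple t) inversions_word.
have [s [sw sk]] := ex _ w erefl; apply: kmin; apply/existsP.
have /eqP sk' := sk; by exists (Tuple sk'); rewrite /= sw.
Qed.

(** Multiplication by a simple reflection on the right is multiplication on the left for the
    inverse, which has the same number of inversions. *)
Lemma min_coset_reps_ltn (I : {set 'I_m.+1}) w i :
  w \in min_coset_reps I -> i \in I -> (w (pos_lo i) < w (pos_hi i))%N.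
Proof.
rewrite inE => /forall_inP wI /wI; rewrite !perm_lengthE => /eqP.
have -> : pcomp w (simple_refl i) = (pcomp (simple_refl i) w^-1)^-1%g.
  by rewrite /Defs.pcomp invMg invgK /simple_refl tpermV.
rewrite inversionsV -[in RHS](inversionsV w).
have [-> _] := inversions_simple (w^-1)%g i; rewrite invgK.
by case: ifP => // _; lia.
Qed.

End Inversions.

Lemma count_enum (T : finType) (P : pred T) : count P (enum T) = #|[set x | P x]|.
Proof.
rewrite -size_filter cardE [in RHS]/enum_mem -enumT; congr size.
by apply: eq_filter => x; rewrite !inE.
Qed.

(** * Weakly decreasing indices, the termination measure and exchanges of positions *)

Section TensorIndices.
Variable m : nat.
Implicit Types (al be : tindex m) (i j : 'I_m.+1).

Lemma tswap_weight r al i :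
  (tswap al i \in weight_indices m r) = (al \in weight_indices m r).
Proof. by apply: weight_indices_comp; exact: perm_inj. Qed.

(** Termination measure of straightening: exchanging the letters of an ascent lowers it by their
    difference. *)
Definition moment al : nat := \sum_(k < m.+2) k * al k.

Lemma moment_tswap al i :
  (al (pos_lo i) < al (pos_hi i))%N -> (moment (tswap al i) < moment al)%N.
Proof.
have split_sum be : moment be = (i * be (pos_lo i) + i.+1 * be (pos_hi i) +
    \sum_(k | (k != pos_lo i) && (k != pos_hi i)) k * be k)%N.
  rewrite /moment (bigD1 (pos_lo i)) //= (bigD1 (pos_hi i)) /=.
    by rewrite /bump /= add1n addnA.
  by rewrite eq_sym pos_lohi.
rewrite !split_sum tswap_lo tswap_hi => lt.
under eq_bigr => k /andP[n1 n2] do rewrite tswap_ne //.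
by rewrite ltn_add2r; nia.
Qed.

Definition weakly_decreasing al : Prop :=
  forall i, (al (pos_hi i) <= al (pos_lo i))%N.

(** The bound [n] is there for indices whose last letter is out of order, as they occur in the
    action of zeta. *)
Lemma decreasing_upto_leq al n (x y : 'I_m.+2) :
  (forall i, (i < n)%N -> (al (pos_hi i) <= al (pos_lo i))%N) ->
  (x <= y <= n)%N -> (al y <= al x)%N.
Proof.
move=> dec; move: {2}(y - x)%N (erefl (y - x)%N) => k; elim: k y => [|k IH] y e xy.
  by have -> : x = y by apply/val_inj => /=; lia.
have ym : (y.-1 < m.+1)%N by have := ltn_ord y; lia.
have yE : y = pos_hi (Ordinal ym) by apply/val_inj; rewrite /= /bump /=; lia.
rewrite yE; apply: leq_trans (dec _ _) _; first by move: xy e => /=; lia.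
by apply: IH => /=; lia.
Qed.

Lemma weakly_decreasing_leq al (x y : 'I_m.+2) :
  weakly_decreasing al -> (x <= y)%N -> (al y <= al x)%N.
Proof.
move=> dec xy; apply: (@decreasing_upto_leq _ m.+1); first by move=> i _; apply: dec.
by rewrite xy -ltnS ltn_ord.
Qed.

(** Equal letter counts make the two lists of letters permutations of each other, and a sorted list
    is determined by its multiset. *)
Lemma weakly_decreasing_weight_inj r al be :
  weakly_decreasing al -> weakly_decreasing be ->
  al \in weight_indices m r -> be \in weight_indices m r -> al = be.
Proof.
move=> da db; rewrite !inE => /forallP ra /forallP rb.
have srt ga : weakly_decreasing ga ->
    sorted (fun x y : 'I_3 => y <= x)%N (map ga (enum 'I_m.+2)).
  move=> dg; apply/(sortedP ord0) => k; rewrite size_map size_enum_ord => km.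
  rewrite !(nth_map ord0 ord0 ga) ?size_enum_ord ?(ltnW km) //.
  by apply: weakly_decreasing_leq => //; rewrite !nth_enum_ord // ltnW.
have /eq_in_map e : map al (enum 'I_m.+2) = map be (enum 'I_m.+2).
  apply: (sorted_eq _ _ (srt _ da) (srt _ db)).
  - by move=> y x z; lia.
  - by move=> x y; rewrite -eqn_leq => /eqP/val_inj.
  apply/seq.permP => P; rewrite (count_map al) (count_map be).
  have cE ga : count (preim ga P) (enum 'I_m.+2) =
      (\sum_(j | P j) #|[set i | ga i == j]|)%N.
    rewrite count_enum -sum1dep_card (partition_big ga P) //=.
    apply: eq_bigr => j Pj; rewrite -sum1dep_card; apply: eq_bigl => x.
    by case: eqP => [->|]; rewrite ?Pj ?andbF.
  apply: etrans (cE al) (etrans _ (esym (cE be))); apply: eq_bigr => j _.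
  by rewrite (eqP (ra j)) (eqP (rb j)).
by apply/ffunP => x; apply: e; rewrite mem_enum.
Qed.

End TensorIndices.

Section DominantIndex.
Variables (m : nat) (r : 'I_3 -> nat).
Hypothesis r_sum : (r ix1 + r ix2 + r ix3 = m.+2)%N.

(** The letters of [alpha_r] as a function on [nat], so that products over [iota] can refer to them
    without ordinals. *)
Definition letter (k : nat) : 'I_3 :=
  if (k < r ix3)%N then ix3 else if (k < r ix3 + r ix2)%N then ix2 else ix1.

Lemma alpha_rE i : alpha_r m r i = letter i.
Proof. by rewrite ffunE. Qed.

Lemma letter_leq k l : (k <= l)%N -> (letter l <= letter k)%N.
Proof. rewrite /letter => kl; case: (ltnP l (r ix3)) => l3; first by rewrite (leq_ltn_trans kl l3).
case: (ltnP l (r ix3 + r ix2)) => l2; last by case: ifP => // _; case: ifP.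
by rewrite (leq_ltn_trans kl l2); case: ifP. Qed.

Lemma alpha_r_decreasing : weakly_decreasing (alpha_r m r).
Proof. by move=> i; rewrite !alpha_rE letter_leq // /= /bump /= add1n. Qed.

Lemma alpha_r_weight : alpha_r m r \in weight_indices m r.
Proof.
rewrite inE; apply/forallP => j.
have -> : #|[set i | alpha_r m r i == j]| = count_mem j (map letter (iota 0 m.+2)).
  rewrite count_map -val_enum_ord count_map count_enum.
  by apply: eq_card => i; rewrite !inE alpha_rE.
have -> : map letter (iota 0 m.+2) =
    nseq (r ix3) ix3 ++ nseq (r ix2) ix2 ++ nseq (r ix1) ix1.
  apply: (@eq_from_nth _ ix1); rewrite size_map size_iota ?size_cat ?size_nseq.
    lia.
  move=> k km; rewrite (nth_map 0%N) ?size_iota // nth_iota // add0n.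
  rewrite !nth_cat !size_nseq !nth_nseq /letter.
  by case: ltnP => // k3; rewrite ltn_subLR //; case: ltnP => // k2; case: ltnP => //; lia.
rewrite !count_cat !count_nseq /=.
by case: j => [[|[|[|]]] // h] /=; rewrite ?mul0n ?mul1n ?add0n ?addn0;
  apply/eqP; congr (r _); apply/val_inj.
Qed.

End DominantIndex.

Section SwapPositions.
Variable m : nat.
Implicit Types (al be : tindex m) (i j : 'I_m.+1).

Lemma tswap_adjacent i j : j = i.+1 :> nat ->
  [/\ pos_hi i = pos_lo j,
      forall al, tswap al i (pos_hi j) = al (pos_hi j)
    & forall al, tswap al j (pos_lo i) = al (pos_lo i)].
Proof.
move=> ji; split=> [|al|al]; first by apply/val_inj; rewrite /= /bump /= ji.
  by rewrite tswap_ne // -val_eqE /= /bump /= ji; lia.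
by rewrite tswap_ne // -val_eqE /= /bump /= ji; lia.
Qed.

(** Either side conjugates one transposition by the other, and both conjugates exchange the outer
    two of the three positions. *)
Lemma tswap_braid al i j : j = i.+1 :> nat ->
  tswap (tswap (tswap al i) j) i = tswap (tswap (tswap al j) i) j.
Proof.
move=> ji; have [hl _ _] := tswap_adjacent ji.
have n1 : pos_lo i != pos_hi j by rewrite -val_eqE /= /bump /= ji; lia.
have n2 := pos_lohi i; have n3 := pos_lohi j.
set t := fun i : 'I_m.+1 => tperm (pos_lo i) (pos_hi i).
have conj i' j' : (t i' * t j' * t i' = t j' ^ t i')%g.
  by rewrite conjgE tpermV mulgA.
have e : (t i * t j * t i = t j * t i * t j)%g.
  rewrite !conj /t !tpermJ hl tpermR tpermL; congr tperm.
    by rewrite tpermD // eq_sym -?hl.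
  by rewrite tpermD // eq_sym -?hl.
by apply/ffunP => k; rewrite !ffunE -!permM -/(t i) -/(t j) !mulgA e.
Qed.

Lemma tswap_far i j : (i.+1 < j)%N || (j.+1 < i)%N ->
  [/\ forall al, tswap al i (pos_lo j) = al (pos_lo j),
      forall al, tswap al i (pos_hi j) = al (pos_hi j)
    & forall al, tswap (tswap al i) j = tswap (tswap al j) i].
Proof.
move=> ij.
have n1 : pos_lo j != pos_lo i by rewrite -val_eqE /=; lia.
have n2 : pos_lo j != pos_hi i by rewrite -val_eqE /= /bump /=; lia.
have n3 : pos_hi j != pos_lo i by rewrite -val_eqE /= /bump /=; lia.
have n4 : pos_hi j != pos_hi i by rewrite -val_eqE /= /bump /=; lia.
split=> [al|al|al]; try by rewrite tswap_ne.
apply/ffunP => k; rewrite !ffunE; congr (al _).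
rewrite [RHS](inj_tperm _ _ _ (@perm_inj _ _)).
by congr (tperm _ _ _); rewrite tpermD // eq_sym.
Qed.

End SwapPositions.

(** * Modules over the Hecke algebra and the diamond lemma *)

Section AlgebraModules.
Variables (K : fieldType) (H : algType K) (M : lmodType H).
Implicit Types (h : H) (x : M) (c : K).

(** The modules carry only an [H]-action, so a scalar of [K] acts through the central element
    [c%:A]. *)
Lemma scale_algC h c x : h *: (c%:A *: x) = c%:A *: (h *: x).
Proof. by rewrite !scalerA mulr_algl mulr_algr. Qed.

Lemma scale_algA b c x : b%:A *: (c%:A *: x) = (b * c)%:A *: x.
Proof. by rewrite scalerA mulr_algl scalerA. Qed.

Lemma scale_alg1 x : 1%:A *: x = x.
Proof. by rewrite !scale1r. Qed.

Lemma scale_alg_lin c h h' x : (c *: h + h') *: x = c%:A *: (h *: x) + h' *: x.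
Proof. by rewrite scalerDl [RHS]addrC [in RHS]scalerA mulr_algl addrC. Qed.

Lemma scale_algD b c x : (b + c)%:A *: x = b%:A *: x + c%:A *: x.
Proof. by rewrite !scalerDl. Qed.

End AlgebraModules.

Section HeckeModules.
Variables (K : fieldType) (m : nat) (q : K) (M : lmodType (hecke m q)).
Implicit Types (h : hecke m q) (x : M) (i j : 'I_m.+1) (c : K).
Local Notation T := (heT q).

Lemma heT_algC i c x : T i *: (c%:A *: x) = c%:A *: (T i *: x).
Proof. exact: scale_algC. Qed.

Lemma heT_braid i j x : j = i.+1 :> nat ->
  T i *: (T j *: (T i *: x)) = T j *: (T i *: (T j *: x)).
Proof.
move=> ji; rewrite !scalerA; congr (_ *: _).
by have := (presented_eqP _ _ _).2 (alg_rel (hecke_braid q ji)); rewrite !presentedM.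
Qed.

Lemma heT_comm i j x : (i.+1 < j)%N || (j.+1 < i)%N ->
  T i *: (T j *: x) = T j *: (T i *: x).
Proof.
move=> ij; rewrite !scalerA; congr (_ *: _).
by have := (presented_eqP _ _ _).2 (alg_rel (hecke_comm q ij)); rewrite !presentedM.
Qed.

Lemma heZ_heT i j x : j = i.+1 :> nat -> heZ m q *: (T i *: x) = T j *: (heZ m q *: x).
Proof.
move=> ji; rewrite !scalerA; congr (_ *: _).
by have := (presented_eqP _ _ _).2 (alg_rel (hecke_zT q ji)); rewrite !presentedM.
Qed.

Hypothesis q0 : q != 0.

Lemma heT_sqr i x : T i *: (T i *: x) = (q - q^-1)%:A *: (T i *: x) + x.
Proof.
have := heTK q0 i; rewrite /heTV mulrBr mulr_algr => /(congr1 (fun h => h *: x)).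
rewrite scalerBl scale1r -!scalerA => /eqP; rewrite subr_eq => /eqP ->.
by rewrite addrC scalerA mulr_algl.
Qed.

(* T_i v_b = (swap_coef b_i b_{i+1}) v_(s_i b) when b_i >= b_{i+1}. *)
Definition swap_coef (a b : 'I_3) : K :=
  if a == b then (if parity a then - q^-1 else q) else bsign K a b.

Lemma swap_coefC a b : swap_coef a b = swap_coef b a.
Proof. by rewrite /swap_coef eq_sym; case: eqP => [->//|_]; rewrite /bsign addnC. Qed.

Lemma swap_coef_neq0 a b : swap_coef a b != 0.
Proof.
rewrite /swap_coef; case: (a =P b) => _; last by rewrite /bsign expf_neq0 ?oppr_eq0 ?oner_eq0.
by case: parity; rewrite ?oppr_eq0 ?invr_eq0.
Qed.

Lemma swap_coef_sqr a b : a != b -> swap_coef a b * swap_coef a b = 1.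
Proof. by rewrite /swap_coef => /negPf ->; rewrite /bsign -expr2 sqrr_sign. Qed.

Variables (r : 'I_3 -> nat) (al : tindex m) (v : M).
Hypotheses (al_dec : weakly_decreasing al) (al_r : al \in weight_indices m r).
Hypothesis Tv : forall i, al (pos_lo i) = al (pos_hi i) ->
  T i *: v = (swap_coef (al (pos_lo i)) (al (pos_hi i)))%:A *: v.

(** Induction hypothesis of the diamond argument: the relations are imposed only at indices of
    moment below [k]. The other index involved, [tswap be i], is [be] itself or has smaller
    moment. *)
Definition straight_below (k : nat) (x : tindex m -> M) : Prop :=
  x al = v /\ forall be i, be \in weight_indices m r -> (moment be < k)%N ->
    (be (pos_lo i) <= be (pos_hi i))%N ->
    T i *: x (tswap be i) = (swap_coef (be (pos_lo i)) (be (pos_hi i)))%:A *: x be.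

Section Extend.
Variables (k : nat) (x : tindex m -> M).
Hypothesis xk : straight_below k x.
Variables (be : tindex m) (i j : 'I_m.+1).
Hypotheses (be_r : be \in weight_indices m r) (be_k : moment be = k).
Hypothesis ltj : (be (pos_lo j) < be (pos_hi j))%N.
Local Notation g ga i := (swap_coef (ga (pos_lo i)) (ga (pos_hi i))).

Let swap_lt (ga : tindex m) i' : (ga (pos_lo i') < ga (pos_hi i'))%N -> (moment ga <= k)%N ->
  (moment (tswap ga i') < k)%N.
Proof. by move=> lt; apply: leq_trans; exact: moment_tswap. Qed.

Let rel (ga : tindex m) i' := xk.2 ga i'.

Let inv1 (ga : tindex m) i' : (ga (pos_lo i') < ga (pos_hi i'))%N -> ga \in weight_indices m r ->
  (moment ga < k)%N -> x ga = (g ga i')%:A *: (T i' *: x (tswap ga i')).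
Proof.
move=> lt gr gk; rewrite rel ?(ltnW lt) // scale_algA swap_coef_sqr ?scale_alg1 //.
by apply: contraTneq lt => ->; rewrite ltnn.
Qed.

(* The value of x at be is forced to be (g be j) T_j x(s_j be); these are the
   two confluence cases for the relation at i. *)
Lemma straight_confluent_eq : be (pos_lo i) = be (pos_hi i) ->
  T i *: (T j *: x (tswap be j)) = (g be i)%:A *: (T j *: x (tswap be j)).
Proof.
move=> eqi; have lti : (be (pos_lo i) <= be (pos_hi i))%N by rewrite eqi.
have nij : i != j by apply: contraTneq ltj => <-; rewrite eqi ltnn.
have jk : (moment (tswap be j) < k)%N by apply: swap_lt; rewrite ?be_k.
have [far|near] := boolP ((i.+1 < j)%N || (j.+1 < i)%N).
  have [l h _] := tswap_far (i := j) (j := i) (etrans (orbC _ _) far).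
  rewrite heT_comm // -heT_algC; congr (_ *: _).
  have := @rel (tswap be j) i; rewrite tswap_weight l h (@tswap_eq _ (tswap be j) i) ?l ?h //.
  by apply.
(* For adjacent [i] and [j], one further exchange at [i] carries the two equal letters to the
   positions of [j]. The braid relation then places [T j] next to that index, where it acts by a
   scalar. *)
have step : (tswap be j (pos_lo i) < tswap be j (pos_hi i))%N ->
    tswap (tswap be j) i (pos_lo j) = be (pos_lo i) ->
    tswap (tswap be j) i (pos_hi j) = be (pos_lo i) ->
    (forall y : M, T i *: (T j *: (T i *: y)) = T j *: (T i *: (T j *: y))) ->
    T i *: (T j *: x (tswap be j)) = (g be i)%:A *: (T j *: x (tswap be j)).
  move=> lt lo hi br; rewrite (inv1 lt) ?tswap_weight // !heT_algC br.
  have := @rel (tswap (tswap be j) i) j.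
  rewrite !tswap_weight lo hi (@tswap_eq _ (tswap (tswap be j) i) j) ?lo ?hi // => -> //; last first.
    by apply: swap_lt => //; apply: ltnW.
  by rewrite !heT_algC -eqi !scale_algA mulrC.
have [ji|ij] : j = i.+1 :> nat \/ i = j.+1 :> nat by move: nij near; rewrite -val_eqE /=; lia.
  have [e hi lo] := tswap_adjacent ji; apply: step.
  - by rewrite lo e tswap_lo eqi e.
  - by rewrite -e tswap_hi lo.
  - by rewrite hi tswap_hi -e -eqi.
  - by move=> y; apply: heT_braid.
have [e hi lo] := tswap_adjacent ij; apply: step.
- by rewrite hi -e tswap_hi -eqi -e.
- by rewrite lo tswap_lo e.
- by rewrite e tswap_lo hi eqi.
- by move=> y; rewrite -heT_braid.
Qed.

Lemma straight_confluent_lt : i != j -> (be (pos_lo i) < be (pos_hi i))%N ->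
  T i *: x (tswap be i) = (g be i * g be j)%:A *: (T j *: x (tswap be j)).
Proof.
move=> nij ilt; have jk : (moment (tswap be j) < k)%N by apply: swap_lt; rewrite ?be_k.
have ik : (moment (tswap be i) < k)%N by apply: swap_lt; rewrite ?be_k.
have ne (ga : tindex m) i' : (ga (pos_lo i') < ga (pos_hi i'))%N -> g ga i' * g ga i' = 1.
  by move=> lt; apply: swap_coef_sqr; apply: contraTneq lt => ->; rewrite ltnn.
have [far|near] := boolP ((i.+1 < j)%N || (j.+1 < i)%N).
  have [lj hj com] := tswap_far far.
  have [li hi _] := tswap_far (i := j) (j := i) (etrans (orbC _ _) far).
  rewrite (@inv1 (tswap be i) j) ?tswap_weight ?lj ?hj //.
  rewrite (@inv1 (tswap be j) i) ?tswap_weight ?li ?hi //.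
  rewrite !heT_algC scale_algA com heT_comm // mulrAC ne //.
  by rewrite mul1r.
(* For adjacent [i] and [j] the three letters strictly increase. Both sides are expanded down to the
   reversed triple, along the two reduced words of the longest permutation of three letters, and the
   braid relation identifies them. *)
have step : (tswap be i (pos_lo j) < tswap be i (pos_hi j))%N ->
    (tswap (tswap be i) j (pos_lo i) < tswap (tswap be i) j (pos_hi i))%N ->
    (tswap be j (pos_lo i) < tswap be j (pos_hi i))%N ->
    (tswap (tswap be j) i (pos_lo j) < tswap (tswap be j) i (pos_hi j))%N ->
    tswap (tswap (tswap be i) j) i = tswap (tswap (tswap be j) i) j ->
    (forall y : M, T i *: (T j *: (T i *: y)) = T j *: (T i *: (T j *: y))) ->
    g (tswap be i) j = g (tswap be j) i ->
    g (tswap (tswap be i) j) i = g be j -> g (tswap (tswap be j) i) j = g be i ->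
    T i *: x (tswap be i) = (g be i * g be j)%:A *: (T j *: x (tswap be j)).
  move=> l1 l2 l3 l4 te br g1 g2 g3.
  rewrite (inv1 l1) ?tswap_weight // (inv1 l2) ?tswap_weight //; last first.
    by apply: swap_lt => //; apply: ltnW.
  rewrite (inv1 l3) ?tswap_weight // (inv1 l4) ?tswap_weight //; last first.
    by apply: swap_lt => //; apply: ltnW.
  rewrite !heT_algC !scale_algA te br g1 g2 g3; congr (_%:A *: _).
  have := ne _ _ ilt; set a := g be i; set b := g be j; set c := swap_coef _ _ => aa.
  by rewrite -[LHS]mulr1 -aa; ring.
have lts : (be (pos_lo i) < be (pos_hi i))%N && (be (pos_lo j) < be (pos_hi j))%N by rewrite ilt.
have [ji|ij] : j = i.+1 :> nat \/ i = j.+1 :> nat by move: nij near; rewrite -val_eqE /=; lia.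
  have [e hi lo] := tswap_adjacent ji.
  have mid (ga : tindex m) : tswap ga i (pos_lo j) = ga (pos_lo i) by rewrite -e tswap_hi.
  have E := (e, mid, hi, lo, @tswap_lo, @tswap_hi).
  have /andP[l1 l2] := lts; rewrite e in l1 l2; have l3 := ltn_trans l1 l2.
  apply: step; do ?rewrite E; rewrite //; first exact: tswap_braid.
  by move=> y; apply: heT_braid.
have [e hi lo] := tswap_adjacent ij.
have mid (ga : tindex m) : tswap ga j (pos_lo i) = ga (pos_lo j) by rewrite -e tswap_hi.
have E := (e, mid, hi, lo, @tswap_lo, @tswap_hi).
have /andP[l1 l2] := lts; rewrite e in l1 l2; have l3 := ltn_trans l2 l1.
apply: step; do ?rewrite E; rewrite //; first exact/esym/tswap_braid.
by move=> y; exact/esym/heT_braid.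
Qed.

End Extend.

Lemma straight_extend k (x : tindex m -> M) :
  straight_below k x -> exists x' : tindex m -> M, straight_below k.+1 x'.
Proof.
(* From moment [k] on, the value is dictated by the relation at one arbitrarily picked ascent, with
   default [v] if there is none. Confluence shows at moment [k] that the relations at the other
   ascents hold as well. *)
move=> xk; pose x' be := if (moment be < k)%N then x be
  else if [pick j | be (pos_lo j) < be (pos_hi j)]%N is Some j
  then (swap_coef (be (pos_lo j)) (be (pos_hi j)))%:A *: (T j *: x (tswap be j)) else v.
have x'k be : (moment be < k)%N -> x' be = x be by rewrite /x' => ->.
exists x'; split.
  rewrite /x'; case: ltnP => // _; first exact: xk.1.
  by case: pickP => // j; rewrite ltnNge al_dec.
move=> be i be_r; rewrite ltnS leq_eqVlt => /orP[/eqP bk|bk] le; last first.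
  rewrite !x'k //; first exact: xk.2.
  move: le; rewrite leq_eqVlt => /orP[/eqP/val_inj/tswap_eq -> //|/moment_tswap lt].
  exact: ltn_trans bk.
have x'lt j : (be (pos_lo j) < be (pos_hi j))%N -> x' (tswap be j) = x (tswap be j).
  by move=> lt; apply: x'k; rewrite -bk; apply: moment_tswap.
have [[j ltj x'be]|[dec x'be]] : (exists2 j, (be (pos_lo j) < be (pos_hi j))%N &
      x' be = (swap_coef (be (pos_lo j)) (be (pos_hi j)))%:A *: (T j *: x (tswap be j)))
    \/ (weakly_decreasing be /\ x' be = v).
- rewrite /x' bk ltnn; case: pickP => [j ltj|dec]; first by left; exists j.
  by right; split=> // j; have := dec j; rewrite /= ltnNge => /negbFE.
- have [eqi|nei] := eqVneq (be (pos_lo i)) (be (pos_hi i)).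
    rewrite tswap_eq // x'be heT_algC (straight_confluent_eq xk be_r bk ltj eqi).
    by rewrite !scale_algA mulrC.
  have lti : (be (pos_lo i) < be (pos_hi i))%N by rewrite ltn_neqAle nei.
  rewrite x'lt // x'be scale_algA; have [->|nij] := eqVneq i j.
    by rewrite swap_coef_sqr ?scale_alg1 //; apply: contraTneq ltj => ->; rewrite ltnn.
  exact: (straight_confluent_lt xk be_r bk ltj nij lti).
(* Without ascents the index is [al], and the relation required is the hypothesis [Tv]. *)
have be_al : be = al by apply: weakly_decreasing_weight_inj be_r al_r.
have eqi : be (pos_lo i) = be (pos_hi i) by apply/val_inj/eqP; rewrite eqn_leq le dec.
by rewrite tswap_eq // x'be Tv -be_al.
Qed.

Lemma straightening : exists2 x : tindex m -> M, x al = v &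
  forall be i, be \in weight_indices m r ->
  (be (pos_lo i) <= be (pos_hi i))%N ->
  T i *: x (tswap be i) = (swap_coef (be (pos_lo i)) (be (pos_hi i)))%:A *: x be.
Proof.
have ex k : exists x : tindex m -> M, straight_below k x.
  by elim: k => [|k [x /straight_extend]] //; exists (fun=> v).
have [x [xal xT]] := ex (\max_(be : tindex m) moment be).+1.
by exists x => // be i be_r le; apply: xT => //; rewrite ltnS; apply: leq_bigmax.
Qed.

End HeckeModules.

(** * The elements Y_j as products of generators *)

Section OrdinalLists.
Variable n : nat.

Lemma filter_enum_ord (P : pred nat) :
  [seq i : 'I_n.+1 <- enum 'I_n.+1 | P i] = map inord [seq i <- iota 0 n.+1 | P i].
Proof.
rewrite -val_enum_ord filter_map -map_comp.
by rewrite [RHS](@eq_map _ _ _ id) ?map_id // => i /=; rewrite inord_val.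
Qed.

Lemma filter_iota_geq j k : (j <= k)%N -> [seq i <- iota 0 k | (j <= i)%N] = iota j (k - j).
Proof.
move=> jk; rewrite -{1}(subnKC jk) iotaD filter_cat add0n.
rewrite (eq_in_filter (a2 := pred0)) ?filter_pred0 => [|i]; last first.
  by rewrite mem_iota /=; case: leqP => // ji; lia.
by apply/all_filterP/allP => i; rewrite mem_iota => /andP[].
Qed.

End OrdinalLists.

Lemma prod_inv_rev (A : pzRingType) (I : Type) (s : seq I) (P : pred I) (F G : I -> A) :
  (forall i, F i * G i = 1) ->
  (\prod_(i <- s | P i) F i) * (\prod_(i <- rev s | P i) G i) = 1.
Proof.
move=> FG; elim/last_ind: s => [|s i IH]; first by rewrite !big_nil mulr1.
rewrite rev_rcons -cats1 big_cat !big_cons !big_nil /=; case: (P i); rewrite ?mulr1 //.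
by rewrite mulrA -[_ * F i * _]mulrA FG mulr1.
Qed.

Section HeckeProducts.
Variables (K : fieldType) (m : nat) (q : K).
Local Notation H := (hecke m q).
Local Notation T i := (heT q (inord i : 'I_m.+1)).

Definition heU (s : seq nat) : H := \prod_(i <- s) T i.
Definition heD (s : seq nat) : H := \prod_(i <- rev s) T i.

Lemma heU_cons i s : heU (i :: s) = T i * heU s.
Proof. exact: big_cons. Qed.

Lemma heD_cons i s : heD (i :: s) = heD s * T i.
Proof. by rewrite /heD rev_cons -cats1 big_cat big_seq1. Qed.

Hypothesis q0 : q != 0.

(** Multiplied by [heU (iota 0 j)] this reads, with indices from zero, zeta T_m ... T_j = T_0 ...
    T_(j-1) Y_j, which is how the eigenvalues of the Y_j give access to zeta. *)
Lemma heU_inv (j : 'I_m.+2) :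
  exists V, [/\ heU (iota 0 j) * V = 1, V * heU (iota 0 j) = 1
    & heY q j = V * heZ m q * heD (iota j (m.+1 - j))].
Proof.
have jm : (j <= m.+1)%N by rewrite -ltnS.
have UE : heU (iota 0 j) = \prod_(i <- enum 'I_m.+1 | (i < j)%N) heT q i.
  rewrite -big_filter (filter_enum_ord m (fun i => i < j)%N) big_map.
  by rewrite (@filter_iota_ltn 0 m.+1 j).
exists (\prod_(i <- rev (enum 'I_m.+1) | (i < j)%N) heTV q i); split.
- by rewrite UE; apply: prod_inv_rev => i; apply: heTK.
- by rewrite UE -{2}(revK (enum 'I_m.+1)); apply: prod_inv_rev => i; apply: heTVK.
rewrite /heY; congr (_ * _ * _); rewrite -big_filter filter_rev.
by rewrite (filter_enum_ord m (leq j)) filter_iota_geq // -map_rev big_map.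
Qed.

End HeckeProducts.

(** * Stability of the span of the lifts under the Hecke algebra *)

Section SpanStability.
Variables (K : fieldType) (m : nat) (q : K) (M : lmodType (hecke m q)).
Variables (r : 'I_3 -> nat) (al : tindex m) (v : M) (x : tindex m -> M).
Hypotheses (q0 : q != 0) (al_dec : weakly_decreasing al) (al_r : al \in weight_indices m r).
Hypothesis x_al : x al = v.
Hypothesis xT : forall be i, be \in weight_indices m r ->
  (be (pos_lo i) <= be (pos_hi i))%N ->
  heT q i *: x (tswap be i) = (swap_coef q (be (pos_lo i)) (be (pos_hi i)))%:A *: x be.
Variable y : 'I_m.+2 -> K.
Hypothesis Yv : forall j, heY q j *: v = (y j)%:A *: v.
Implicit Types (h : hecke m q) (u : M) (be ga : tindex m) (i : 'I_m.+1).

Definition straight_sum (c : tindex m -> K) : M :=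
  \sum_(be in weight_indices m r) (c be)%:A *: x be.

Definition straight_span u : Prop := exists c, u = straight_sum c.

Lemma straight_span0 : straight_span 0.
Proof. by exists (fun=> 0); rewrite /straight_sum big1 // => be _; rewrite !scale0r. Qed.

Lemma straight_spanD u u' : straight_span u -> straight_span u' -> straight_span (u + u').
Proof.
move=> [c ->] [c' ->]; exists (fun be => c be + c' be).
by rewrite /straight_sum -big_split; apply: eq_bigr => be _; rewrite !scalerDl.
Qed.

Lemma straight_spanZ a u : straight_span u -> straight_span (a%:A *: u).
Proof.
move=> [c ->]; exists (fun be => a * c be).
by rewrite /straight_sum scaler_sumr; apply: eq_bigr => be _; rewrite scale_algA.
Qed.

Lemma straight_span_x be : be \in weight_indices m r -> straight_span (x be).
Proof.
move=> be_r; exists (fun ga => (ga == be)%:R); rewrite /straight_sum (bigD1 be) //=.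
rewrite eqxx scale_alg1 big1 ?addr0 // => ga /andP[_ /negPf ->].
by rewrite !scale0r.
Qed.

Lemma straight_span_scale h u :
  (forall be, be \in weight_indices m r -> straight_span (h *: x be)) ->
  straight_span u -> straight_span (h *: u).
Proof.
move=> hx [c ->]; rewrite /straight_sum scaler_sumr.
apply: big_ind => [||be be_r]; [exact: straight_span0|exact: straight_spanD|].
by rewrite scale_algC; apply/straight_spanZ/hx.
Qed.

Lemma x_ascent be i : be \in weight_indices m r -> (be (pos_lo i) < be (pos_hi i))%N ->
  x be = (swap_coef q (be (pos_lo i)) (be (pos_hi i)))%:A *: (heT q i *: x (tswap be i)).
Proof.
move=> be_r lt; rewrite xT ?(ltnW lt) // scale_algA swap_coef_sqr ?scale_alg1 //.
by apply: contraTneq lt => ->; rewrite ltnn.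
Qed.

(** At an ascent [x be] already contains a factor [T_i], and the quadratic relation reduces the
    square; otherwise the relation at [tswap be i] applies directly. *)
Lemma straight_span_heT i u : straight_span u -> straight_span (heT q i *: u).
Proof.
apply: straight_span_scale => be be_r.
have [lt|ge] := ltnP (be (pos_lo i)) (be (pos_hi i)).
  rewrite (x_ascent be_r lt) heT_algC heT_sqr //.
  rewrite xT ?(ltnW lt) //; apply: straight_spanZ; apply: straight_spanD.
    by do 2 apply: straight_spanZ; apply: straight_span_x.
  by apply: straight_span_x; rewrite tswap_weight.
have := @xT (tswap be i) i; rewrite tswap_weight tswap_lo tswap_hi tswapK => ->//.
by apply: straight_spanZ; apply: straight_span_x; rewrite tswap_weight.
Qed.

(** The letter at [j] is the only one that may exceed letters before it. While it is out of order it
    moves one step left, and the [T] released by this step extends the descending product. Once the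
    index is sorted it is [al], and the product with zeta becomes [heU] times Y_j, of which [v] is
    an eigenvector. *)
Lemma straight_span_heZD j ga : (j <= m.+1)%N -> ga \in weight_indices m r ->
  (forall a b : 'I_m.+2, (a < b)%N -> b != j :> nat -> (ga b <= ga a)%N) ->
  straight_span (heZ m q *: (heD m q (iota j (m.+1 - j)) *: x ga)).
Proof.
have sorted j' ga' : (j' <= m.+1)%N -> ga' \in weight_indices m r ->
    weakly_decreasing ga' ->
    straight_span (heZ m q *: (heD m q (iota j' (m.+1 - j')) *: x ga')).
  move=> jm gr gd; rewrite (weakly_decreasing_weight_inj gd al_dec gr al_r) x_al.
  have [V [UV _ YE]] := heU_inv q0 (inord j' : 'I_m.+2).
  rewrite inordK // in UV YE; rewrite scalerA -[X in X *: v]mul1r -UV -!mulrA.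
  rewrite [V * _]mulrA -YE -scalerA Yv scale_algC; apply: straight_spanZ.
  elim: (iota 0 j') => [|i s IH]; last by rewrite heU_cons -scalerA; apply: straight_span_heT.
  by rewrite /heU big_nil scale1r -x_al; apply: straight_span_x.
elim: j ga => [|j IH] ga jm gr gd.
  by apply: sorted => // i; apply: gd.
pose i : 'I_m.+1 := inord j; have ij : i = j :> nat by rewrite inordK.
have lo : pos_lo i = j :> nat by rewrite /= ij.
have hi : pos_hi i = j.+1 :> nat by rewrite pos_hiE ij.
have [lt|ge] := ltnP (ga (pos_lo i)) (ga (pos_hi i)); last first.
  apply: sorted => // i'; have [e|ne] := eqVneq (pos_hi i' : nat) j.+1.
    have -> // : i' = i by apply/val_inj; rewrite [RHS]ij; move: e; rewrite pos_hiE => -[].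
  by apply: gd => //; rewrite pos_hiE.
rewrite (x_ascent gr lt) !scale_algC; apply: straight_spanZ.
rewrite [heD _ _ _ *: _]scalerA -heD_cons.
have -> : j :: iota j.+1 (m.+1 - j.+1) = iota j (m.+1 - j) by rewrite -(subnSK jm).
apply: IH; rewrite ?tswap_weight ?(ltnW jm) // => a b ab bj.
have [bE|nb] := eqVneq b (pos_hi i).
  rewrite bE tswap_hi; have [->|na] := eqVneq a (pos_lo i); first by rewrite tswap_lo ltnW.
  rewrite tswap_ne //; last by apply: contraTneq ab => ->; rewrite bE ltnn.
  apply: gd; last by rewrite lo; lia.
  have na' : a != j :> nat by rewrite -lo.
  by move: na' ab; rewrite bE hi lo; lia.
have nb' : b != pos_lo i by rewrite -lo in bj.
have nh : b != j.+1 :> nat by rewrite -hi.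
rewrite [tswap ga i b]tswap_ne // /tswap ffunE; apply: gd => //.
by case: tpermP => [e|e|_ _ //]; move: ab; rewrite e hi lo; move: nh bj; lia.
Qed.

(** An ascent not involving the last position is removed by zeta T_i = T_(i+1) zeta, with induction
    on the moment. If there is none, only the last letter can be out of order, which is
    [straight_span_heZD] with an empty product. *)
Lemma straight_span_heZ u : straight_span u -> straight_span (heZ m q *: u).
Proof.
apply: straight_span_scale => be.
have [k] := ubnP (moment be); elim: k be => // k IH be bk be_r.
have [i /andP[im lt]|dec] := pickP (fun i : 'I_m.+1 => (i < m) && (be (pos_lo i) < be (pos_hi i)))%N.
  have im' : (inord i.+1 : 'I_m.+1) = i.+1 :> nat by rewrite inordK.
  rewrite (x_ascent be_r lt) scale_algC (heZ_heT _ im').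
  apply/straight_spanZ/straight_span_heT/IH; last by rewrite tswap_weight.
  exact: leq_trans (moment_tswap lt) bk.
have := @straight_span_heZD m.+1 be (leqnn _) be_r.
rewrite subnn /heD big_nil scale1r; apply=> a b ab bm.
apply: (@decreasing_upto_leq _ _ m); last by rewrite (ltnW ab) /=; have := ltn_ord b; lia.
by move=> i im; have := dec i; rewrite im /= ltnNge => /negbFE.
Qed.

Section Inverse.
Variables (W : lmodType (hecke m q)) (psi : M -> W) (sec : W -> M).
Hypotheses (psiZ : forall h u, psi (h *: u) = h *: psi u)
  (sec_span : forall w, straight_span (sec w)) (secK : cancel sec psi)
  (psiK : forall u, straight_span u -> sec (psi u) = u).

(* heZ is injective on the span and sec provides a preimage, so that the span
   is stable under the inverse of heZ. *)
Lemma straight_span_heZV u : straight_span u -> straight_span (heZV m q *: u).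
Proof.
move=> su; have := psiK (straight_span_heZ (sec_span (heZV m q *: psi u))).
rewrite psiZ secK scalerA heZK scale1r psiK // => ->.
by rewrite scalerA heZVK scale1r.
Qed.

Lemma straight_span_full h : straight_span (h *: v).
Proof.
have : straight_span v by rewrite -x_al; apply: straight_span_x.
case: (presented_surj h) => s ->; move: v; elim: s => [g|c|s IHs t IHt|s IHs t IHt] u su.
- case: g => [i||]; [exact: straight_span_heT|exact: straight_span_heZ|].
  exact: straight_span_heZV.
- by rewrite presentedC; apply: straight_spanZ.
- by rewrite presentedD scalerDl; apply: straight_spanD; [apply: IHs|apply: IHt].
- by rewrite presentedM -scalerA; apply/IHs/IHt.
Qed.

End Inverse.

End SpanStability.

(** * The spin representation on basis tensors *)

Section BasisOperators.
Variables (K : fieldType) (m : nat) (q : K) (d : 'I_3 -> K).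
Implicit Types (be ga : tindex m) (i : 'I_m.+1).

Lemma tswap_eqE ga be i : (tswap ga i == be) = (ga == tswap be i).
Proof. by apply/eqP/eqP => [<-|->]; rewrite tswapK. Qed.

Lemma T_op_tbasis i be : (be (pos_hi i) <= be (pos_lo i))%N ->
  T_op q i (tbasis K be) =
  swap_coef q (be (pos_lo i)) (be (pos_hi i)) *: tbasis K (tswap be i).
Proof.
move=> ge; apply/ffunP => ga; rewrite T_opE !ffunE.
rewrite tswap_eqE.
have [eq_be|ne_be] := eqVneq (be (pos_lo i)) (be (pos_hi i)).
  rewrite tswap_eq // eq_be; case: (ga =P be) => [->|_]; last by rewrite !mulr0 addr0 scaler0.
  by rewrite /Bdiag /Boff /swap_coef eq_be eqxx !mulr1 addr0 [RHS]mulr1.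
have swE : (tswap be i == be) = false.
  apply: contra_neqF ne_be => /eqP/ffunP/(_ (pos_lo i)); rewrite tswap_lo => ->; exact: erefl.
case: (ga =P tswap be i) => [->|_].
  rewrite swE mulr0 add0r mulr1 tswap_lo tswap_hi /Boff /swap_coef eq_sym.
  by rewrite (negPf ne_be) [RHS]mulr1 /bsign addnC.
rewrite mulr0 addr0 scaler0; case: (ga =P be) => [->|_]; last by rewrite mulr0.
by rewrite mulr1 /Bdiag (negPf ne_be) ltnNge ge.
Qed.

Lemma Z_op_tbasis be : Z_op d (tbasis K be) =
  d (be ord_max) *: tbasis K (foldr (fun i b => tswap b i) be (enum 'I_m.+1)).
Proof.
rewrite /Z_op; elim: (enum _) => [|i s IH] /=; last first.
  rewrite IH; apply/ffunP => ga; rewrite P_opE !ffunE.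
  by rewrite tswap_eqE.
apply/ffunP => ga; rewrite loc1_diag !ffunE.
by case: (ga =P be) => [->|_]; rewrite ?mulr0 ?scaler0 ?[RHS]mulr1 ?mulr1.
Qed.

End BasisOperators.

Section SpinAction.
Variables (R : realType) (p : R) (m : nat) (kappa : R[i]) (phi : 'rV[R[i]]_3).
Local Notation C := R[i].
Local Notation q := (hecke_param p kappa).
Local Notation V := (spin_module p m kappa phi).
Implicit Types (be : tindex m).

Definition spin_vec be : V := vtensor R be.
Local Notation g := (swap_coef q).

Lemma hecke_param_neq0 : q != 0.
Proof. exact: cpow_neq0. Qed.

Lemma spin_heT_vec (i : 'I_m.+1) be : (be (pos_hi i) <= be (pos_lo i))%N ->
  heT q i *: spin_vec be =
  (g (be (pos_lo i)) (be (pos_hi i)))%:A *: spin_vec (tswap be i).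
Proof. by move=> ge; rewrite spin_heT spin_scale /spin_vec /vtensor T_op_tbasis. Qed.

Lemma spin_heZ_vec be : heZ m q *: spin_vec be =
  (spin_twist p phi (be ord_max))%:A
  *: spin_vec (foldr (fun i b => tswap b i) be (enum 'I_m.+1)).
Proof. by rewrite spin_heZ spin_scale /spin_vec /vtensor Z_op_tbasis. Qed.

Variables (r : 'I_3 -> nat).
Local Notation a := (letter r).
Local Notation al := (alpha_r m r).
Local Notation ord_seq s := (map (fun i : nat => inord i : 'I_m.+1) s).

(** The descending product carries the letter at [j] to the right past [l] letters, none of them
    larger, so each [T] acts by a single term. The last two conjuncts keep the induction going:
    where the travelling letter is, and that nothing beyond it has moved. *)
Lemma spin_heD j l : (j + l <= m.+1)%N ->
  let be := foldl (@tswap m) al (ord_seq (iota j l)) in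
  [/\ heD m q (iota j l) *: spin_vec al =
        (\prod_(i <- iota j l) g (a j) (a i.+1))%:A *: spin_vec be,
      be (inord (j + l)) = a j
    & forall k : 'I_m.+2, (j + l < k)%N -> be k = a k].
Proof.
elim: l => [|l IH] jl.
  rewrite /heD /= !big_nil addn0 scale_alg1 scale1r; split=> // [|k _].
    by rewrite alpha_rE inordK // ltnS -[j]addn0.
  by rewrite alpha_rE.
have jlm : (j + l < m.+1)%N by rewrite -addnS.
have [IH1 IH2 IH3] := IH (ltnW jlm).
rewrite -[l.+1]addn1 iotaD map_cat foldl_cat /= big_cat big_seq1.
move: IH1 IH2 IH3; set be := foldl _ _ _ => IH1 IH2 IH3.
set i : 'I_m.+1 := inord (j + l); have iE : i = (j + l)%N :> nat by rewrite inordK.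
have lo : be (pos_lo i) = a j.
  by rewrite -IH2; congr (be _); apply/val_inj; rewrite /= iE inordK // ltnW.
have hiE : pos_hi i = (j + l).+1 :> nat by rewrite pos_hiE iE.
have hi : be (pos_hi i) = a (j + l).+1 by rewrite IH3 hiE.
split.
- have -> : heD m q (iota j l ++ [:: (j + l)%N]) = heT q i * heD m q (iota j l).
    by rewrite /heD rev_cat big_cat big_seq1.
  rewrite -scalerA IH1 scale_algC spin_heT_vec; last by rewrite lo hi letter_leq //; lia.
  by rewrite scale_algA lo hi.
- have -> : inord (j + (l + 1)) = pos_hi i.
    by apply/val_inj; rewrite [RHS]hiE /= inordK addn1 addnS.
  by rewrite tswap_hi.
- move=> k jk; rewrite tswap_ne; first by rewrite IH3 //; lia.
    by apply: contraTneq jk => ->; rewrite /= iE; lia.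
  by apply: contraTneq jk => ->; rewrite hiE; lia.
Qed.

Lemma spin_heU k l : (k + l <= m.+1)%N ->
  let be := foldr (fun i b => tswap b i) al (ord_seq (iota k l)) in
  [/\ heU m q (iota k l) *: spin_vec al =
        (\prod_(i <- iota k l) g (a i) (a (k + l)))%:A *: spin_vec be,
      be (inord k) = a (k + l)
    & forall i : 'I_m.+2, (i < k)%N -> be i = a i].
Proof.
elim: l k => [|l IH] k kl.
  rewrite /heU /= !big_nil scale_alg1 scale1r addn0; split=> // [|i _].
    by rewrite alpha_rE inordK // ltnS -[k]addn0.
  by rewrite alpha_rE.
have [IH1 IH2 IH3] := IH k.+1 (leq_trans (eq_leq (addSnnS _ _)) kl).
rewrite /= heU_cons big_cons -scalerA IH1 -addSnnS.
move: IH1 IH2 IH3; set be := foldr _ _ _ => IH1 IH2 IH3.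
have km : (k < m.+1)%N by lia.
set i : 'I_m.+1 := inord k; have iE : i = k :> nat by rewrite inordK.
have hiE : pos_hi i = k.+1 :> nat by rewrite pos_hiE iE.
have hi : be (pos_hi i) = a (k.+1 + l).
  by rewrite -IH2; congr (be _); apply/val_inj; rewrite [LHS]hiE /= inordK.
have lo : be (pos_lo i) = a k by rewrite IH3 /= iE.
split.
- rewrite scale_algC spin_heT_vec; last by rewrite lo hi letter_leq //; lia.
  by rewrite scale_algA lo hi mulrC.
- have -> : inord k = pos_lo i by apply/val_inj; rewrite /= iE inordK // ltnW.
  by rewrite tswap_lo.
- move=> j jk; rewrite tswap_ne; first by rewrite IH3 //; lia.
    by apply: contraTneq jk => ->; rewrite /= iE; lia.
  by apply: contraTneq jk => ->; rewrite hiE; lia.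
Qed.

Lemma foldr_foldl_tswap be (s : seq 'I_m.+1) :
  foldr (fun i b => tswap b i) (foldl (@tswap m) be s) s = be.
Proof. by elim: s be => //= i s IH be; rewrite IH tswapK. Qed.

Definition spin_eigenvalue (j : nat) : C :=
  spin_twist p phi (a j) * \prod_(i <- iota j (m.+1 - j)) g (a j) (a i.+1)
  / \prod_(i <- iota 0 j) g (a i) (a j).

(** The descending product takes the letter at [j] to the right end, and zeta twists it and moves it
    to the front. Up to a scalar, [heU (iota 0 j)] produces the same tensor from [al], so its
    inverse [V] returns to [al]. *)
Lemma spin_heY (j : 'I_m.+2) :
  heY q j *: spin_vec al = (spin_eigenvalue j)%:A *: spin_vec al.
Proof.
have jm : (j <= m.+1)%N by rewrite -ltnS.
have [e eE] : exists e, e = spin_eigenvalue j by exists (spin_eigenvalue j).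
rewrite -eE; have [V [_ VU ->]] := heU_inv hecke_param_neq0 j.
have [] := @spin_heD j (m.+1 - j); rewrite subnKC //.
have -> : inord m.+1 = ord_max :> 'I_m.+2 by apply/val_inj; rewrite /= inordK.
move=> D1 D2 _; have [U1 _ _] := @spin_heU 0 j jm.
rewrite -!scalerA D1 !scale_algC spin_heZ_vec D2.
have -> : enum 'I_m.+1 = ord_seq (iota 0 j) ++ ord_seq (iota j (m.+1 - j)).
  by rewrite -map_cat -[X in iota X (_ - _)]add0n -iotaD subnKC // -val_enum_ord -map_comp;
     rewrite -[LHS]map_id; apply: eq_map => i /=; rewrite inord_val.
rewrite foldr_cat foldr_foldl_tswap.
set be := foldr _ _ _ in U1 *; set c := \prod_(i <- _) _ in U1.
have c0 : c != 0.
  apply: (big_rec (fun c => c != 0)) => [|i x _ x0]; rewrite ?oner_neq0 //.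
  by rewrite mulf_neq0 // swap_coef_neq0 ?hecke_param_neq0.
have -> : spin_vec be = (c^-1)%:A *: (heU m q (iota 0 j) *: spin_vec al).
  by rewrite U1 scale_algA mulVf // scale_alg1.
rewrite !(scale_algC V) !scale_algA [V *: _]scalerA VU scale1r eE.
by rewrite /spin_eigenvalue -/c [spin_twist _ _ _ * _]mulrC.
Qed.

End SpinAction.

(** * Complex powers and the eigenvalues of the Y_j *)

Section ComplexPower.
Variable R : realType.
Local Notation C := R[i].

Lemma cexpD (z w : C) : cexp (z + w) = cexp z * cexp w.
Proof.
case: z => a b; case: w => c d; rewrite /cexp /= expRD cosD sinD.
by apply/eqP; rewrite eq_complex /=; apply/andP; split; apply/eqP; ring.
Qed.

Variable p : R.

Lemma cpowD (a b : C) : cpow p (a + b) = cpow p a * cpow p b.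
Proof. by rewrite /cpow mulrDl cexpD. Qed.

Lemma cpow0 : cpow p 0 = 1.
Proof.
apply: (mulfI (cpow_neq0 p 0)); rewrite -cpowD addr0 mulr1; exact: erefl.
Qed.

Lemma cpowN (a : C) : cpow p (- a) = (cpow p a)^-1.
Proof.
by apply: (mulfI (cpow_neq0 p a)); rewrite -cpowD subrr cpow0 mulfV ?cpow_neq0.
Qed.

Lemma cpowMn (a : C) n : cpow p (n%:R * a) = cpow p a ^+ n.
Proof.
elim: n => [|n IH]; first by rewrite mul0r cpow0.
by rewrite -addn1 natrD mulrDl mul1r cpowD IH addn1 exprSr.
Qed.

(** A logarithm of -1 to the base [p]: it turns the signs of the braiding into the exponents found
    in [eta1], [eta2] and [eta3]. *)
Definition pi_over_log : C := (0 +i* trigo.pi)%C / (ln p)%:C%C.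

Lemma cpow_pi_over_log : 0 < p -> p < 1 -> cpow p pi_over_log = -1.
Proof.
move=> p0 p1; have l0 : (ln p)%:C%C != 0 :> C.
  by rewrite eq_complex /= eqxx andbT lt_eqF // ln_lt0 // p0.
rewrite /cpow /pi_over_log divfK //= expR0 cospi sinpi mulr0 mul1r.
by apply/eqP; rewrite eq_complex /= oppr0 !eqxx.
Qed.

End ComplexPower.

Lemma prod_iota_const (A : pzRingType) (F : nat -> A) c j l :
  (forall i, (j <= i < j + l)%N -> F i = c) -> \prod_(i <- iota j l) F i = c ^+ l.
Proof.
move=> Fc; rewrite (eq_big_seq (fun=> c)) => [|i]; last by rewrite mem_iota; apply: Fc.
by rewrite big_const_seq count_predT size_iota iter_mulr_1.
Qed.

Section Eigenvalue.
Variables (R : realType) (p : R) (m : nat) (kappa : R[i]) (phi : 'rV[R[i]]_3).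
Variable r : 'I_3 -> nat.
Hypotheses (p_gt0 : 0 < p) (p_lt1 : p < 1).
Hypothesis r_sum : (r ix1 + r ix2 + r ix3 = m.+2)%N.
Local Notation C := R[i].
Local Notation q := (hecke_param p kappa).
Local Notation a := (letter r).
Local Notation w := (pi_over_log p).

Let g33 : swap_coef q ix3 ix3 = cpow p (w + kappa).
Proof.
by rewrite /swap_coef /= /hecke_param cpowN invrK cpowD cpow_pi_over_log // mulN1r.
Qed.

(** As [cpow p w] is its own inverse, [w] may keep its sign under inversion. With this choice the
    exponents agree with [gamma_r] identically, not merely modulo a period of [cpow p]. *)
Let g33V : (swap_coef q ix3 ix3)^-1 = cpow p (w - kappa).
Proof.
rewrite /swap_coef /= /hecke_param cpowD cpow_pi_over_log // mulN1r.
by rewrite invrN invrK.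
Qed.

Let g3 b : b != ix3 -> swap_coef q ix3 b = cpow p w.
Proof.
move=> b3; rewrite /swap_coef eq_sym (negPf b3) /bsign cpow_pi_over_log //.
by case: b b3 => [[|[|[|]]] //].
Qed.

Let gV3 b : b != ix3 -> (swap_coef q ix3 b)^-1 = cpow p w.
Proof. by move=> b3; rewrite g3 // cpow_pi_over_log // invrN1. Qed.

Let gbb b : b != ix3 -> swap_coef q b b = cpow p (- kappa).
Proof. by rewrite /swap_coef eqxx; case: b => [[|[|[|]]] //]. Qed.

Let g21 : swap_coef q ix2 ix1 = 1.
Proof. by rewrite /swap_coef /= /bsign expr0. Qed.

Let prod_split (F : nat -> C) j l k : (l <= k)%N ->
  \prod_(i <- iota j k) F i = (\prod_(i <- iota j l) F i) * \prod_(i <- iota (j + l) (k - l)) F i.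
Proof. by move=> lk; rewrite -{1}(subnKC lk) iotaD big_cat. Qed.

Let a3 i : (i < r ix3)%N -> a i = ix3.
Proof. by rewrite /letter => ->. Qed.
Let a2 i : (r ix3 <= i < r ix3 + r ix2)%N -> a i = ix2.
Proof. by move=> /andP[h1 h2]; rewrite /letter ltnNge h1 h2. Qed.
Let a1 i : (r ix3 + r ix2 <= i)%N -> a i = ix1.
Proof.
by rewrite /letter => h; rewrite ltnNge (leq_trans (leq_addr _ _) h) ltnNge h.
Qed.

Lemma spin_eigenvalueE (j : 'I_m.+2) :
  spin_eigenvalue p m kappa phi r j = cpow p (- gamma_r p kappa phi r j).
Proof.
have jm := ltn_ord j; rewrite /spin_eigenvalue /spin_twist /gamma_r /eta1 /eta2 /eta3.
rewrite -[(_ +i* _)%C / _]/w.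
have [j3|j3] := ltnP j (r ix3).
  rewrite (@prod_split _ j (r ix3 - j.+1)); last lia.
  rewrite (@prod_iota_const _ _ (swap_coef q ix3 ix3)); last first.
    by move=> i ij; rewrite !a3 //; lia.
  rewrite (@prod_iota_const _ _ (swap_coef q ix3 ix1)); last first.
    move=> i ij; rewrite a3 // !g3 // /letter; case: ifP; [lia|by case: ifP].
  rewrite (@prod_iota_const _ _ (swap_coef q ix3 ix3) 0); last first.
    by move=> i ij; rewrite !a3 //; lia.
  rewrite a3 // -exprVn g33V g33 g3 // -!cpowMn -!cpowD; congr cpow.
  rewrite !natrB; try lia.
  have -> : m.+1%:R = (m.+2%:R - 1 :> C) by rewrite -[m.+2]addn1 natrD addrK.
  rewrite -[j.+1]addn1 -[(r ix3).+1]addn1 !natrD; ring.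
have [j2|j2] := ltnP j (r ix3 + r ix2).
  rewrite a2 ?j3 //.
  rewrite (@prod_split _ j (r ix3 + r ix2 - j.+1)); last lia.
  rewrite (@prod_iota_const _ _ (swap_coef q ix2 ix2)); last first.
    by move=> i ij; rewrite !a2 //; lia.
  rewrite (@prod_iota_const _ _ 1); last by move=> i ij; rewrite a1 ?g21 //; lia.
  rewrite (@prod_split _ 0 (r ix3)) // (@prod_iota_const _ _ (swap_coef q ix3 ix2) 0); last first.
    by move=> i ij; rewrite a3 //; lia.
  rewrite (@prod_iota_const _ _ (swap_coef q ix2 ix2)); last first.
    by move=> i ij; rewrite a2 //; lia.
  rewrite expr1n mulr1 invfM -[(swap_coef _ _ _ ^+ r ix3)^-1]exprVn gV3 // gbb //.
  rewrite -!cpowMn -cpowN -!cpowD; congr cpow.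
  rewrite !natrB; try lia.
  rewrite -[j.+1]addn1 -[(r ix2).+1]addn1 !natrD; ring.
rewrite a1 //.
rewrite (@prod_iota_const _ _ (swap_coef q ix1 ix1)); last first.
  by move=> i ij; rewrite a1 //; lia.
rewrite (@prod_split _ 0 (r ix3)); last lia.
rewrite (@prod_split _ (0 + r ix3) (r ix2)); last lia.
rewrite (@prod_iota_const _ _ (swap_coef q ix3 ix1) 0); last first.
  by move=> i ij; rewrite a3 //; lia.
rewrite (@prod_iota_const _ _ 1); last by move=> i ij; rewrite a2 ?g21 //; lia.
rewrite (@prod_iota_const _ _ (swap_coef q ix1 ix1)); last first.
  by move=> i ij; rewrite a1 //; lia.
rewrite expr1n mul1r invfM -[(swap_coef _ _ _ ^+ r ix3)^-1]exprVn gV3 // gbb //.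
rewrite -!cpowMn -cpowN -!cpowD; congr cpow.
rewrite !natrB; try lia.
have -> : m.+1%:R = ((r ix1)%:R + (r ix2)%:R + (r ix3)%:R - 1 :> C).
  by rewrite -!natrD r_sum -[m.+2]addn1 natrD addrK.
rewrite -[j.+1]addn1 -[(r ix1).+1]addn1 !natrD; ring.
Qed.

End Eigenvalue.

Local Notation induced := Defs.induced.

(** * The induced module: universal property and cyclicity *)

Section InducedUniversal.
Variables (K : fieldType) (H : algType K) (A : set H) (chi : H -> K).
Variables (W : lmodType H) (w0 : W).
Hypothesis w0_chi : forall a, A a -> a *: w0 = (chi a)%:A *: w0.

Fixpoint tens_eval (s : tens_expr H) : W :=
  match s with
  | TZero => 0
  | TAdd s t => tens_eval s + tens_eval t
  | TOpp s => - tens_eval s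
  | TPure h c => h *: (c%:A *: w0)
  end.

(** The balancing relation is respected exactly because [w0] is an eigenvector of [A] with character
    [chi]. *)
Lemma tens_eval_eq s t : tens_eq A chi s t -> tens_eval s = tens_eval t.
Proof.
elim=> {s t} //=.
- by move=> s t u _ -> _ ->.
- by move=> s s' t t' _ -> _ ->.
- by move=> s s' _ ->.
- by move=> s t u; rewrite addrA.
- by move=> s t; rewrite addrC.
- by move=> s; rewrite add0r.
- by move=> s; rewrite addNr.
- by move=> g h c; rewrite scalerDl.
- by move=> h c d; rewrite scalerDl scalerDl scalerDr.
- by move=> h a c Aa; rewrite -[LHS]scalerA scale_algC w0_chi // scale_algA mulrC.
Qed.

Definition induced_map (u : induced A chi) : W := tens_eval (generic_quotient.repr u).

Lemma induced_mapE s : induced_map (induced_of A chi s) = tens_eval s.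
Proof. exact/tens_eval_eq/induced_repr. Qed.

Lemma induced_map_linear : linear induced_map.
Proof.
move=> g u u'; have [s ->] := induced_surj u; have [t ->] := induced_surj u'.
have -> : g *: induced_of A chi s = induced_of A chi (tens_scale g s).
  exact: induced_scaleE.
have -> : induced_of A chi (tens_scale g s) + induced_of A chi t =
    induced_of A chi (TAdd (tens_scale g s) t) by exact: induced_addE.
rewrite !induced_mapE /=; congr (_ + _).
elim: s => [|s IHs s' IHs'|s IHs|h c] /=.
- by rewrite scaler0.
- by rewrite IHs IHs' scalerDr.
- by rewrite IHs scalerN.
- by rewrite -[LHS]scalerA.
Qed.

Lemma induced_map_tensor : induced_map (ind_tensor A chi 1 1) = w0.
Proof. by rewrite induced_mapE /= !scale1r. Qed.

End InducedUniversal.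

Section InducedGenerator.
Variables (K : fieldType) (H : algType K) (A : set H) (chi : H -> K).
Hypothesis A_alg : forall c : K, A c%:A.
Hypothesis chi_alg : forall c : K, chi c%:A = c.
Local Notation v0 := (ind_tensor A chi 1 1).

Let tensor_alg h c : ind_tensor A chi h c = (c *: h) *: v0.
Proof.
rewrite [RHS]induced_scaleE /= mulr1 -mulr_algr; apply/induced_eqP/tens_sym.
apply: tens_trans (tens_balanced _ _ _ (A_alg c)) _.
by rewrite chi_alg mulr1; apply: tens_refl.
Qed.

Lemma induced_generator (u : induced A chi) : exists h, u = h *: v0.
Proof.
have [s ->] := induced_surj u; elim: s => [|s [g gE] t [h hE]|s [g gE]|h c].
- by exists 0; rewrite scale0r.
- exists (g + h); rewrite scalerDl -gE -hE; apply/esym; exact: induced_addE.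
- exists (- g); rewrite scaleNr -gE; apply/esym; exact: induced_oppE.
- by exists (c *: h); rewrite -tensor_alg.
Qed.

Lemma induced_generator_chi a : A a -> a *: v0 = (chi a)%:A *: v0.
Proof.
move=> Aa; rewrite -tensor_alg [LHS]induced_scaleE /= mulr1; apply/induced_eqP.
rewrite -{1}[a]mul1r -[chi a]mulr1; exact: tens_balanced.
Qed.

End InducedGenerator.

(** * The subalgebra H_I(q) and its characters *)

Section PrincipalCharacter.
Variables (R : realType) (p : R) (m : nat) (kappa : R[i]).
Local Notation C := R[i].
Local Notation q := (hecke_param p kappa).
Local Notation H := (hecke m q).
Variable I : {set 'I_m.+1}.
Local Notation A := (@hecke_sub R p m kappa I).
Local Open Scope classical_set_scope.

Lemma hecke_sub_ind (B : set H) :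
  B 1 -> (forall c g h, B g -> B h -> B (c *: g + h)) ->
  (forall g h, B g -> B h -> B (g * h)) ->
  (forall i, i \in I -> B (heT q i)) -> (forall j, B (heY q j) /\ B (heYV q j)) ->
  A `<=` B.
Proof.
move=> B1 BZ BM BT BY h; apply; split; last first.
  move=> _ [[[i iI <-]|[j _ <-]]|[j _ <-]]; first exact: BT.
    exact: (BY j).1.
  exact: (BY j).2.
split; first exact/mem_set.
  by move=> c u w /set_mem Bu /set_mem Bw; apply/mem_set/BZ.
by move=> u w /set_mem Bu /set_mem Bw; apply/mem_set/BM.
Qed.

Lemma hecke_sub_closed :
  [/\ A 1, forall c g h, A g -> A h -> A (c *: g + h) & forall g h, A g -> A h -> A (g * h)].
Proof.
split=> [B [[B1 _ _] _]|c g h Ag Ah B AB|g h Ag Ah B AB]; apply: set_mem => //.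
  by have [[_ BZ _] _] := AB; apply: BZ; apply: mem_set; [exact: Ag AB|exact: Ah AB].
by have [[_ _ BM] _] := AB; apply: BM; apply: mem_set; [exact: Ag AB|exact: Ah AB].
Qed.

Lemma hecke_sub_gen : (forall i, i \in I -> A (heT q i)) /\
  (forall j, A (heY q j) /\ A (heYV q j)).
Proof.
split=> [i iI B [_]|j]; first by apply; left; left; exists i.
by split=> B [_]; apply; [left; right; exists j|right; exists j].
Qed.

Lemma hecke_sub_alg c : A c%:A.
Proof.
have [A1 AZ _] := hecke_sub_closed; have A0 : A 0.
  by have := AZ (-1) _ _ A1 A1; rewrite scaleN1r addNr.
by have := AZ c _ _ A1 A0; rewrite addr0.
Qed.

Section Eigenvector.
Variables (W : lmodType H) (w : W) (chi : H -> C).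
Hypothesis chi_char : linear_character A chi.

(** The elements of [A] acting on [w] through [chi] are closed under the algebra operations, so
    generators suffice. For the inverse of Y_j, multiplicativity makes [chi] invertible on Y_j. *)
Lemma character_eigenvector :
  (forall i, i \in I -> heT q i *: w = (chi (heT q i))%:A *: w) ->
  (forall j, heY q j *: w = (chi (heY q j))%:A *: w) ->
  forall a, A a -> a *: w = (chi a)%:A *: w.
Proof.
move=> Tw Yw; have [A1 AZ AM] := hecke_sub_closed; have [AT AY] := hecke_sub_gen.
case: chi_char => chi1 chiD chiM chiZ.
have B : A `<=` [set a | A a /\ a *: w = (chi a)%:A *: w].
  apply: hecke_sub_ind => [|c g h [Ag gw] [Ah hw]|g h [Ag gw] [Ah hw]|i iI|j].
  - by rewrite /= chi1 scale_alg1 scale1r.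
  - split; first exact: AZ.
    have Acg : A (c *: g).
      rewrite -[_ *: _]addr0; apply: AZ => //.
      by rewrite -(scale0r 1); apply: hecke_sub_alg.
    rewrite chiD ?chiZ; try exact: mem_set.
    by rewrite scale_alg_lin gw hw scale_algA -scale_algD.
  - split; first exact: AM.
    rewrite chiM; try exact: mem_set.
    by rewrite -scalerA hw scale_algC gw scale_algA mulrC.
  - by split; [apply: AT|apply: Tw].
  - have [YV VY] := heYK (cpow_neq0 p (- kappa)) j; have [AYj AVj] := AY j.
    split; split=> //.
    have chiV : chi (heY q j) * chi (heYV q j) = 1.
      by rewrite -chiM ?YV ?chi1 //; apply: mem_set.
    have := congr1 (fun u => (chi (heYV q j))%:A *: (heYV q j *: u)) (Yw j).
    rewrite scalerA VY scale1r scale_algC scale_algA mulrC chiV scale_alg1 => ->.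
    by [].
by move=> a /B[].
Qed.

End Eigenvector.
End PrincipalCharacter.

(** * The isomorphism [psi_r] *)

Section SpinPrincipalSeries.
Variables (R : realType) (p : R) (m : nat) (kappa : R[i]) (phi : 'rV[R[i]]_3).
Variable r : 'I_3 -> nat.
Hypotheses (p_gt0 : 0 < p) (p_lt1 : p < 1).
Hypothesis r_sum : (r ix1 + r ix2 + r ix3 = m.+2)%N.
Local Notation C := R[i].
Local Notation q := (hecke_param p kappa).
Local Notation H := (hecke m q).
Local Notation I := (I_r m r).
Local Notation A := (@hecke_sub R p m kappa I).
Local Notation K_r := (weight_indices m r).
Local Notation al := (alpha_r m r).
Local Notation vec be := (spin_vec p kappa phi be).
Local Notation gamma := (gamma_r p kappa phi r).
Local Notation V := (spin_module p m kappa phi).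
Implicit Types (be ga : tindex m) (i : 'I_m.+1) (h : H).

Let coord (u : V) be : C := (u : tspace C m) be.

Let coordD u u' be : coord (u + u') be = coord u be + coord u' be.
Proof. by rewrite /coord ffunE. Qed.

Let coordZ c u be : coord (c%:A *: u) be = c * coord u be.
Proof. by rewrite /coord spin_scale ffunE. Qed.

Let coord_vec be ga : coord (vec be) ga = (ga == be)%:R.
Proof. by rewrite /coord /spin_vec /vtensor ffunE. Qed.

Let coord_eigen h c : h *: vec al = c%:A *: vec al -> coord (h *: vec al) al = c.
Proof. by move=> ->; rewrite coordZ coord_vec eqxx mulr1. Qed.

Lemma mem_I_r i : (i \in I) = (al (pos_lo i) == al (pos_hi i)).
Proof.
rewrite inE !alpha_rE pos_hiE /letter.
have im := ltn_ord i; rewrite /=; apply/idP/eqP => [/andP[n1 n2]|].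
  have -> : (i.+1 < r ix3)%N = (i < r ix3)%N by lia.
  by have -> : (i.+1 < r ix3 + r ix2)%N = (i < r ix3 + r ix2)%N by lia.
case: (ltnP i (r ix3)); case: (ltnP i.+1 (r ix3)) => //; try lia.
  by move=> _ _; case: ifP.
case: (ltnP i (r ix3 + r ix2)); case: (ltnP i.+1 (r ix3 + r ix2)) => //; lia.
Qed.

Lemma spin_heT_alpha i : i \in I ->
  heT q i *: vec al = ((sgnz (eps_r r i))%:~R * q ^ sgnz (eps_r r i))%:A *: vec al.
Proof.
rewrite mem_I_r => /eqP e; rewrite spin_heT_vec ?e // tswap_eq //; congr (_%:A *: _).
rewrite -e alpha_rE /swap_coef eqxx /eps_r /sgnz /letter /=.
have : i \in I by rewrite mem_I_r e.
rewrite inE => /andP[n1 _].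
have -> : (i.+1 < r ix3)%N = (i < r ix3)%N by lia.
case: ltnP => _ /=; first by rewrite expr1 mulN1r.
by case: ifP => [|_]; [case: ifP|rewrite expr0 mul1r].
Qed.

Lemma spin_heY_alpha j : heY q j *: vec al = (cpow p (- gamma j))%:A *: vec al.
Proof. by rewrite spin_heY spin_eigenvalueE. Qed.

(** [principal_char] is chosen by [xget], so a witness is required. The coefficient of [vec al] in
    [h *: vec al] is linear in [h], and multiplicative on [A] because [vec al] is a common
    eigenvector there. *)
Lemma principal_charP :
  is_principal_char I (eps_r r) gamma (@principal_char R p m kappa I (eps_r r) gamma).
Proof.
apply: xgetPex; pose chi h := coord (h *: vec al) al; exists chi.
have eigen : (A `<=` [set h | h *: vec al = (chi h)%:A *: vec al])%classic.
  have eigenP h c : h *: vec al = c%:A *: vec al -> h *: vec al = (chi h)%:A *: vec al.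
    by move=> e; rewrite /chi (coord_eigen e).
  apply: hecke_sub_ind => [|c g h|g h|i iI|j] /=.
  - by apply: (eigenP _ 1); rewrite scale_alg1 scale1r.
  - move=> eg eh; apply: (eigenP _ (c * chi g + chi h)).
    by rewrite scale_alg_lin eg eh scale_algA -scale_algD.
  - move=> eg eh; apply: (eigenP _ (chi h * chi g)).
    by rewrite -[LHS]scalerA eh scale_algC eg scale_algA.
  - by apply: eigenP (spin_heT_alpha iI).
  - split; first by apply: eigenP (spin_heY_alpha j).
    apply: (eigenP _ (cpow p (- gamma j))^-1).
    have [_ VY] := heYK (hecke_param_neq0 p kappa) j.
    have := congr1 (fun u => ((cpow p (- gamma j))^-1)%:A *: (heYV q j *: u)) (spin_heY_alpha j).
    by rewrite scalerA VY scale1r scale_algC scale_algA mulVf ?cpow_neq0 // scale_alg1 => ->.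
have [AT AY] := @hecke_sub_gen R p m kappa I.
split.
- split=> [|g h _ _|g h /set_mem Ag /set_mem Ah|c h _].
  + by rewrite /chi scale1r coord_vec eqxx.
  + by rewrite /chi scalerDl coordD.
  + rewrite /chi -scalerA (eigen h Ah) scale_algC (eigen g Ag) !coordZ coord_vec.
    by rewrite eqxx !mulr1 mulrC.
  + by rewrite /chi -mulr_algl -scalerA coordZ.
- by move=> i iI; rewrite /chi (coord_eigen (spin_heT_alpha iI)).
- by move=> j; rewrite /chi (coord_eigen (spin_heY_alpha j)).
Qed.

Local Notation chi := (@principal_char R p m kappa I (eps_r r) gamma).
Local Notation M := (principal_series_r p m kappa phi r).
Local Notation W := (weight_space p m kappa phi r).
Local Notation v0 := (cyclic_vector_r p m kappa phi r).

Let chi_alg c : chi c%:A = c.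
Proof.
have [[chi1 _ _ chiZ] _ _] := principal_charP.
have A1 : A 1 by have [] := @hecke_sub_closed R p m kappa I.
by rewrite chiZ ?chi1 ?mulr1 //; apply: mem_set.
Qed.

Lemma cyclic_vector_chi a : A a -> a *: v0 = (chi a)%:A *: v0.
Proof. exact: induced_generator_chi (@hecke_sub_alg R p m kappa I) chi_alg a. Qed.

Lemma cyclic_vector_gen (u : M) : exists h, u = h *: v0.
Proof. exact: induced_generator (@hecke_sub_alg R p m kappa I) chi_alg u. Qed.

Lemma vec_weight be : be \in K_r -> vec be \in @weight_pred R p m kappa phi r.
Proof.
move=> be_r; rewrite unfold_in; apply/weight_vspaceP => ga nga.
rewrite -/(coord (vec be) ga) coord_vec; case: eqP => // e.
by rewrite e be_r in nga.
Qed.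

Definition weight_vec be (be_r : be \in K_r) : W := WeightSpace (vec_weight be_r).
Local Notation w0 := (weight_vec (alpha_r_weight r_sum)).

Lemma weight_vec_chi a : A a -> a *: w0 = (chi a)%:A *: w0.
Proof.
have [chi_lin chiT chiY] := principal_charP.
move=> Aa; apply: val_inj; rewrite /= -[LHS]/(a *: vec al) -[RHS]/((chi a)%:A *: vec al).
apply: (character_eigenvector chi_lin) Aa => [i iI|j].
  by rewrite chiT // spin_heT_alpha.
by rewrite chiY spin_heY_alpha.
Qed.

Definition psi_r : M -> W := @induced_map _ _ A chi W w0.

Lemma psi_r_linear : linear psi_r.
Proof. exact: induced_map_linear weight_vec_chi. Qed.

Lemma psi_r_cyclic : psi_r v0 = w0.
Proof. exact: induced_map_tensor weight_vec_chi. Qed.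

Let psiZ h u : psi_r (h *: u) = h *: psi_r u.
Proof.
have psi0 : psi_r 0 = 0.
  by have := psi_r_linear (-1) 0 0; rewrite scaler0 addr0 scaleN1r addNr.
by have := psi_r_linear h u 0; rewrite psi0 !addr0.
Qed.

Let psiD u u' : psi_r (u + u') = psi_r u + psi_r u'.
Proof. by have := psi_r_linear 1 u u'; rewrite !scale1r. Qed.

Section Straightened.
Variable x : tindex m -> M.
Hypothesis x_al : x al = v0.
Hypothesis xT : forall be i, be \in K_r -> (be (pos_lo i) <= be (pos_hi i))%N ->
  heT q i *: x (tswap be i) = (swap_coef q (be (pos_lo i)) (be (pos_hi i)))%:A *: x be.
Let q0 := hecke_param_neq0 p kappa.

(** Lifts and basis tensors obey the same recursion at ascents and agree at [al]. *)
Let psi_x be : be \in K_r -> weight_val (psi_r (x be)) = vec be.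
Proof.
have [k] := ubnP (moment be); elim: k be => // k IH be bk be_r.
have [i lt|dec] := pickP (fun i : 'I_m.+1 => be (pos_lo i) < be (pos_hi i))%N; last first.
  rewrite (@weakly_decreasing_weight_inj _ r be al) ?alpha_r_weight //.
  - by rewrite x_al psi_r_cyclic.
  - by move=> i; have := dec i; rewrite /= ltnNge => /negbFE.
  - exact: alpha_r_decreasing.
rewrite (x_ascent xT be_r lt) !psiZ /= IH ?tswap_weight //; last first.
  exact: leq_trans (moment_tswap lt) bk.
rewrite -[_ *: _]/(_%:A *: (heT q i *: vec _)) spin_heT_vec; last first.
  by rewrite tswap_lo tswap_hi ltnW.
rewrite tswapK tswap_lo tswap_hi [swap_coef q (be (pos_hi i)) _]swap_coefC.
rewrite scale_algA swap_coef_sqr ?scale_alg1 //.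
by apply: contraTneq lt => ->; rewrite ltnn.
Qed.

Let psi_sum c ga : ga \in K_r ->
  coord (weight_val (psi_r (straight_sum r x c))) ga = c ga.
Proof.
move=> ga_r; pose f u := coord (weight_val (psi_r u)) ga.
have f0 : f 0 = 0.
  have psi0 : psi_r 0 = 0 by have := psiZ 0 0; rewrite !scale0r.
  by rewrite /f psi0 /coord /= ffunE.
have fD : {morph f : u u' / u + u'} by move=> u u'; rewrite /f psiD /= coordD.
rewrite -/(f _) /straight_sum (big_morph f fD f0) (bigD1 ga) //= big1 => [|be /andP[be_r ne]].
  by rewrite /f psiZ /= coordZ psi_x // coord_vec eqxx mulr1 addr0.
by rewrite /f psiZ /= coordZ psi_x // coord_vec eq_sym (negPf ne) mulr0.
Qed.

(** A right inverse of [psi_r], and a left inverse on the span of the lifts; bijectivity follows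
    once that span is everything. *)
Let sec (z : W) : M := straight_sum r x (coord (weight_val z)).

Let secK : cancel sec psi_r.
Proof.
move=> z; apply/val_inj/ffunP => ga; have [ga_r|nga] := boolP (ga \in K_r).
  exact: psi_sum.
by have /weight_vspaceP -> := valP z => //; have /weight_vspaceP -> := valP (psi_r (sec z)).
Qed.

Let psi_sumK c : sec (psi_r (straight_sum r x c)) = straight_sum r x c.
Proof. by apply: eq_bigr => be be_r; rewrite psi_sum. Qed.

Lemma psi_r_bij_straight : bijective psi_r.
Proof.
exists sec => // u; have [h ->] := cyclic_vector_gen u.
have Yv j : heY q j *: v0 = (cpow p (- gamma j))%:A *: v0.
  have [_ _ <-] := principal_charP; apply: cyclic_vector_chi.
  by have [_ /(_ j)[]] := @hecke_sub_gen R p m kappa I.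
have [c ->] : straight_span r x (h *: v0); last exact: psi_sumK.
apply: (straight_span_full q0 (@alpha_r_decreasing m r) (alpha_r_weight r_sum) x_al xT Yv
  psiZ _ secK) => [z|_ [c ->]]; last exact: psi_sumK.
by exists (coord (weight_val z)).
Qed.

End Straightened.

Lemma psi_r_bij : bijective psi_r.
Proof.
have [_ chiT _] := principal_charP.
have [AT _] := @hecke_sub_gen R p m kappa I.
have Tv i : al (pos_lo i) = al (pos_hi i) ->
    heT q i *: v0 = (swap_coef q (al (pos_lo i)) (al (pos_hi i)))%:A *: v0.
  move=> e; have iI : i \in I by rewrite mem_I_r e.
  rewrite cyclic_vector_chi; last exact: AT.
  rewrite chiT // -(coord_eigen (spin_heT_alpha iI)) spin_heT_vec ?e //.
  by rewrite coordZ tswap_eq // coord_vec eqxx mulr1.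
have [x x_al xT] := straightening (hecke_param_neq0 p kappa) (@alpha_r_decreasing m r)
  (alpha_r_weight r_sum) Tv.
exact: psi_r_bij_straight x_al xT.
Qed.

Lemma psi_r_unique (f : M -> W) :
  linear f -> weight_val (f v0) = vtensor R al -> f = psi_r.
Proof.
move=> f_lin fv; apply/funext => u; have [h ->] := cyclic_vector_gen u.
have f0 : f 0 = 0 by have := f_lin (-1) 0 0; rewrite scaler0 addr0 scaleN1r addNr.
have := f_lin h v0 0; rewrite f0 !addr0 psiZ => ->; congr (_ *: _).
by apply: val_inj; rewrite psi_r_cyclic.
Qed.

Lemma psi_r_scale h : weight_val (psi_r (h *: v0)) = h *: vec al.
Proof. by rewrite psiZ psi_r_cyclic. Qed.

(** * Images of the vectors attached to minimal coset representatives *)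

Section Words.
Local Notation pcomp := Defs.pcomp.
Implicit Types (w : 'S_m.+2).

Lemma perm_act_simple w i be :
  perm_act (pcomp (simple_refl i) w) be = tswap (perm_act w be) i.
Proof. by apply/ffunP => k; rewrite !ffunE invMg permM /simple_refl tpermV. Qed.

Let parity_alpha (j : 'I_m.+2) : parity (al j) = (j < r ix3)%N.
Proof. by rewrite alpha_rE /letter; case: ifP => // _; case: ifP. Qed.

(** Reducedness and minimality are expressed by counting inversions and by monotonicity on equal
    letters, since both conditions visibly pass to the tail of the word. *)
Lemma spin_heT_word (s : seq 'I_m.+1) : size s = inversions (word_perm s) ->
  (forall c d : 'I_m.+2, (c < d)%N -> al c = al d -> (word_perm s c < word_perm s d)%N) ->
  heT_word p kappa s *: vec al =
    ((-1) ^+ sign_exponent r (word_perm s))%:A *: vec (perm_act (word_perm s) al).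
Proof.
elim: s => [|i s IH] /=.
  move=> _ _; rewrite /heT_word big_nil scale1r.
  have -> : perm_act 1 al = al by apply/ffunP => k; rewrite ffunE invg1 perm1.
  have -> : sign_exponent r (1 : 'S_m.+2)%g = 0%N; last by rewrite expr0 scale_alg1.
  apply/eqP; rewrite cards_eq0; apply/eqP/setP => -[k l]; rewrite !inE /= !perm1.
  by apply/negP => /andP[/andP[h1 h2]]; lia.
set w := word_perm s; pose c := (w^-1)%g (pos_lo i); pose d := (w^-1)%g (pos_hi i).
have wc : w c = pos_lo i by rewrite permKV.
have wd : w d = pos_hi i by rewrite permKV.
move=> sz inc; have [invE _] := inversions_simple w i.
have sw := inversions_word s; rewrite -/w in sw.
(* A first letter that removed an inversion would leave fewer inversions than the word has
   letters. *)
have cd : (c < d)%N.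
  move: invE; rewrite -/c -/d -sz; case: ifP => // _ e.
  by move: e sw; case: (inversions w) => [|k] /=; lia.
have szw : size s = inversions w by move: invE; rewrite -/c -/d cd -sz => -[].
have lo_hi : (pos_lo i < pos_hi i)%N by rewrite pos_hiE.
have ne : al c != al d.
  apply/eqP => /(inc _ _ cd); rewrite !pcompE wc wd /simple_refl tpermL tpermR.
  by rewrite ltnNge (ltnW lo_hi).
have incw (c' d' : 'I_m.+2) : (c' < d')%N -> al c' = al d' -> (w c' < w d')%N.
  move=> cd' e; have := inc _ _ cd' e; rewrite !pcompE simple_refl_ltn //.
    rewrite -wc -wd xpair_eqE !(inj_eq perm_inj); apply/negP => /andP[/eqP e1 /eqP e2].
    by case/eqP: ne; rewrite -e1 -e2.
  rewrite -wc -wd xpair_eqE !(inj_eq perm_inj); apply/negP => /andP[/eqP e1 /eqP e2].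
  by move: cd'; rewrite e1 e2 ltnNge (ltnW cd).
have -> : heT_word p kappa (i :: s) = heT q i * heT_word p kappa s by apply: big_cons.
rewrite -scalerA (IH szw incw) heT_algC perm_act_simple.
have act_lo : perm_act w al (pos_lo i) = al c by rewrite ffunE.
have act_hi : perm_act w al (pos_hi i) = al d by rewrite ffunE.
have ge : (al d <= al c)%N.
  by apply: weakly_decreasing_leq (@alpha_r_decreasing m r) (ltnW cd).
rewrite spin_heT_vec act_lo act_hi // scale_algA; congr (_%:A *: _).
rewrite /swap_coef (negPf ne) /bsign -exprD; apply/eqP.
(* Otherwise [c] and [d] both lie in the block of threes. Hence the letter at [d] is even, and the
   sign is -1 exactly when [c] is in that block, which is when [sign_exponent] grows by one. *)
have d3 : (r ix3 <= d)%N.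
  rewrite leqNgt; apply: contra ne => d3.
  by rewrite !alpha_rE /letter d3 (ltn_trans cd d3).
have := @pair_inversions_simple _ (fun a b => a < r ix3 <= b)%N w i.
rewrite /= -/c -/d !parity_alpha d3 andbT (ltnNge d) d3 /= !addn0 => e.
by apply/eqP/esym; congr (_ ^+ _); exact: e.
Qed.

Lemma psi_r_word (w : 'S_m.+2) s : w \in min_coset_reps I -> reduced_word w s ->
  weight_val (psi_r (heT_word p kappa s *: v0)) =
  (-1) ^+ sign_exponent r w *: vtensor R (perm_act w al).
Proof.
move=> w_min [sw sz]; rewrite psi_r_scale spin_heT_word ?sw; first by rewrite spin_scale.
  by rewrite sz perm_lengthE.
have adj i : al (pos_lo i) = al (pos_hi i) -> (w (pos_lo i) < w (pos_hi i))%N.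
  by move=> e; apply: min_coset_reps_ltn w_min _; rewrite mem_I_r e.
(* Equal letters of [al] occupy consecutive positions, so monotonicity at adjacent positions
   propagates to all pairs. *)
move=> c d; have [k] := ubnP (d - c)%N; elim: k d => // k IH d dk cd e.
have dm : (d.-1 < m.+1)%N by have := ltn_ord d; lia.
pose i := Ordinal dm; have dE : d = pos_hi i by apply/val_inj; rewrite /= /bump /=; lia.
have cd' : (c <= pos_lo i)%N by move: cd => /=; lia.
have al_lo : al (pos_lo i) = al d.
  have := @alpha_r_decreasing m r i; rewrite -dE => le.
  apply/val_inj/eqP; rewrite eqn_leq le andbT -e.
  exact: weakly_decreasing_leq (@alpha_r_decreasing m r) cd'.
have step : (w (pos_lo i) < w d)%N by have := adj i; rewrite -dE; apply.
move: cd'; rewrite leq_eqVlt => /orP[/eqP/val_inj -> //|cd'].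
apply: ltn_trans step; apply: IH => //; last by rewrite al_lo.
by move: dk cd' cd => /=; lia.
Qed.

End Words.
End SpinPrincipalSeries.

Theorem proposition5p4 (R : realType) (p : R) (p_gt0 : 0 < p) (p_lt1 : p < 1)
    (m : nat) (r : 'I_3 -> nat) (r_sum : (r ix1 + r ix2 + r ix3 = m.+2)%N) :
  generic_parameters (fun (kappa : R[i]) (phi : 'rV[R[i]]_3) =>
    exists psi : principal_series_r p m kappa phi r -> weight_space p m kappa phi r,
      unique (fun f : principal_series_r p m kappa phi r -> weight_space p m kappa phi r =>
        [/\ linear f, bijective f
          & weight_val (f (cyclic_vector_r p m kappa phi r))
            = vtensor R (alpha_r m r)]) psi
      /\ forall w : 'S_m.+2, w \in min_coset_reps (I_r m r) ->
         forall s : seq 'I_m.+1, reduced_word w s ->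
           weight_val (psi (heT_word p kappa s *: cyclic_vector_r p m kappa phi r))
           = (-1) ^+ sign_exponent r w *: vtensor R (perm_act w (alpha_r m r))).
Proof.
exists (fun=> cst 1); split=> [_|kappa phi _].
  by split=> [z|]; [exact: differentiable_cst|exists 0; exact: oner_neq0].
exists (@psi_r R p m kappa phi r r_sum); split; last by move=> w w_min s; apply: psi_r_word.
split; last by move=> f [f_lin _ f_cyc]; apply/esym/psi_r_unique.
split; [exact: psi_r_linear|exact: psi_r_bij|by rewrite psi_r_cyclic].
Qed.
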